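(* Consider the duplicated redundant system with renewal described in the context, with primary unit failure rate $\lambda$, standby unit failure rate $\lambda'$, repair time distribution function $G$, and busy periods $W_1,W_2,\dots$. Let $\tau$ and $\eta$ be independent, $\tau$ exponential with parameter $\lambda$ and $\mathbf{P}(\eta<t)=G(t)$, and let $q=\mathbf{P}(\tau<\eta)=1-\int_0^\infty e^{-\lambda x}\,dG(x)$. Then $$\mathbf{D}W_1=\frac{\sigma^2}{q}+\frac{a^2(q-1)+2aa_0}{q^2},$$ where $$a=\frac{q}{\lambda}+\frac{1}{\lambda+\lambda'},\qquad \sigma^2=\frac{2-q^2}{\lambda^2}+\frac{1}{(\lambda+\lambda')^2}-2\int_0^\infty te^{-\lambda t}G(t)\,dt,$$ $$a_0=\int_0^\infty te^{-\lambda t}\,dG(t)+\frac{1-q}{\lambda+\lambda'},$$ and for every $k\ge2$ $$\mathbf{D}W_k=\mathbf{D}W_1-\frac{1}{(\lambda+\lambda')^2}.$$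
   Context: $\mathbf{D}$ denotes variance. The system consists of one operating (primary) unit, one standby unit and one repair unit. The failure-free time of the operating unit is exponential with parameter $\lambda>0$; a unit in (light) standby can also fail, with failure-free time exponential with parameter $\lambda'$, $0<\lambda'<\lambda$; the repair time has an arbitrary distribution function $G(t)=\mathbf{P}(\eta<t)$ with $G(0+)=0$. All failure-free times and repair times are independent. A failed operating unit is immediately replaced by the standby unit if that one is good; a failed unit is repaired (one at a time), after which it is as good as new. Let $\xi(t)\in\{0,1,2\}$ be the number of defective units at time $t$, with $\xi(0)=0$ a.s. Explicitly: in state $0$ the operating unit and the standby unit have independent exponential($\lambda$) and exponential($\lambda'$) lifetimes, and at the first of the two failures the system enters state $1$; on entering state $1$ the good unit operates with remaining lifetime exponential($\lambda$) (memorylessness), and a repair with a new independent repair time distributed as $\eta$ starts for the other unit; if the repair ends before the operating unit fails the system returns to state $0$, otherwise at the failure of the operating unit the system enters state $2$. In state $2$ the current repair is completed, whereupon the system enters state $1$: the repaired unit starts operating and a new repair of the other unit starts. A busy period is a maximal time interval on which at least one unit is functioning (state $0$ or $1$); $W_k$ is the length of the $k$-th busy period, so $W_1$ is the time of the first entry to state $2$. *)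

(* Defs.v *)
From HB Require Import structures.
From mathcomp Require Import all_boot all_order all_algebra.
From mathcomp Require Import all_classical all_reals all_analysis.

Set Implicit Arguments.
Unset Strict Implicit.
Unset Printing Implicit Defensive.
Import Order.TTheory GRing.Theory Num.Theory.
Import numFieldNormedType.Exports.
Local Open Scope classical_set_scope.
Local Open Scope ring_scope.

(* Distribution functions in the convention G(t) = P(eta < t), hence
   left-continuous. *)
Record distrFun (R : realType) := DistrFun {
  df :> R -> R ;
  df_nondecreasing : {homo df : x y / x <= y} ;
  df_left_continuous : forall t : R, df x @[x --> t^'-] --> df t ;
  df_ninfty : df x @[x --> -oo] --> (0 : R) ;
  df_pinfty : df x @[x --> +oo] --> (1 : R) }.

Section stieltjes.
Context {R : realType}.
Implicit Type G : distrFun R.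

(* G(t+).  The library builds Lebesgue-Stieltjes measures from right-continuous
   functions; the measure dG of the left-continuous G, dG([a, b[) = G b - G a,
   is the one built from t |-> G(t+), dG(]a, b]) = G(b+) - G(a+). *)
Definition right_limit G (t : R) : R := lim (G x @[x --> t^'+]).

Lemma right_limit_cvg G t : G x @[x --> t^'+] --> right_limit G t.
Proof.
apply: (@nondecreasing_at_right_is_cvgr R G t).
- by near=> x => a b _ _; exact: df_nondecreasing.
- near=> x; exists (G t) => _ [y /= + <-].
  by rewrite in_itv/= => /andP[/ltW ty _]; exact: df_nondecreasing.
Unshelve. all: by end_near. Qed.

Lemma right_limit_le G t x : t < x -> right_limit G t <= G x.
Proof.
move=> tx; apply: limr_le; first exact: right_limit_cvg.
near=> y; apply: df_nondecreasing.
by near: y; exact: nbhs_right_le.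
Unshelve. all: by end_near. Qed.

Lemma le_right_limit G t x : x <= t -> G x <= right_limit G t.
Proof.
move=> xt; apply: limr_ge; first exact: right_limit_cvg.
near=> y; apply: df_nondecreasing; apply: (le_trans xt).
by near: y; exact: nbhs_right_ge.
Unshelve. all: by end_near. Qed.

Lemma right_limit_nondecreasing G : {homo right_limit G : x y / x <= y}.
Proof.
move=> x y; rewrite le_eqVlt => /predU1P[->//|xy].
by rewrite (le_trans (right_limit_le G xy))// le_right_limit.
Qed.

Lemma right_limit_right_continuous G : right_continuous (right_limit G).
Proof.
move=> t; apply/cvgrPdist_le => e e0.
have /cvgrPdist_le/(_ e e0) h := @right_limit_cvg G t.
have [d /= d0 dG] := h.
near=> x.
have tx : t < x by near: x; exact: nbhs_right_gt.
have xd : x < t + d by near: x; apply: nbhs_right_lt; rewrite ltrDl.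
pose y := (x + (t + d)) / 2.
have xy : x < y by rewrite /y midf_lt.
have yd : y < t + d by rewrite /y midf_lt.
have ty := lt_trans tx xy.
rewrite ler0_norm; last by rewrite subr_le0 right_limit_nondecreasing// ltW.
rewrite opprB; apply: (@le_trans _ _ (G y - right_limit G t)).
  by rewrite lerB// right_limit_le.
rewrite (le_trans (ler_norm _))// distrC dG//=.
by rewrite distrC gtr0_norm ?subr_gt0// ltrBlDl.
Unshelve. all: by end_near. Qed.

HB.instance Definition _ G := isCumulative.Build R _ R (right_limit G)
  (@right_limit_nondecreasing G) (@right_limit_right_continuous G).

Definition stieltjes G := lebesgue_stieltjes_measure (right_limit G).

End stieltjes.

Section random_variables.
Context d (T : measurableType d) (R : realType) (P : probability T R).

Definition exponential_RV (rate : R) (X : {RV P >-> R}) :=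
  forall A : set R, measurable A ->
    distribution P X A = exponential_prob rate A.

Definition mutually_independent (I : eqType) (X : I -> {RV P >-> R}) :=
  forall (s : seq I) (A : I -> set R), uniq s ->
    (forall i, measurable (A i)) ->
    P (\bigcap_(i in [set` s]) X i @^-1` A i)
      = (\prod_(i <- s) P (X i @^-1` A i))%E.

Definition pair_family (X Y : {RV P >-> R}) (b : bool) : {RV P >-> R} :=
  if b then X else Y.

Definition join_family (I J : Type) (X : I -> {RV P >-> R})
    (Y : J -> {RV P >-> R}) (k : I + J) : {RV P >-> R} :=
  match k with inl i => X i | inr j => Y j end.

End random_variables.

(* A sample path of the system, driven by sequences of clock values.  The
   clocks read during the stay that follows the n-th change of state are
   - oper n, standby n : lifetimes of the operating and of the standby unit,
     if that stay is in state 0;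
   - resid n, repair n : remaining lifetime of the operating unit and duration
     of the repair that starts, if that stay is in state 1.
   No new clock is read in state 2, where the current repair is completed. *)
Section sample_path.
Context {R : realType}.
Variables oper standby resid repair : nat -> R.

(* (time of entry, number of defective units, remaining repair time); the last
   component is used in state 2 only.  A tie resid n = repair n, an event of
   probability zero, is counted as a return to state 0. *)
Definition config : Type := R * nat * R.

Definition step (n : nat) (c : config) : config :=
  let: (t, s, r) := c in
  match s with
  | 0%N => (t + Num.min (oper n) (standby n), 1%N, 0)
  | 1%N => if resid n < repair n
           then (t + resid n, 2%N, repair n - resid n)
           else (t + repair n, 0%N, 0)
  | _ => (t + r, 1%N, 0)
  end.

Fixpoint config_after (n : nat) : config :=
  if n is m.+1 then step m (config_after m) else (0, 0%N, 0).

Definition jump_time (n : nat) : R := (config_after n).1.1.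
Definition jump_state (n : nat) : nat := (config_after n).1.2.

(* The number of defective units at time t.  Almost surely the jump times
   increase strictly to infinity, so that exactly one n qualifies. *)
Definition xi (t : R) : nat :=
  jump_state (xget 0%N [set n | jump_time n <= t < jump_time n.+1]).

(* Beginning of the busy period that follows j completed ones, given that the
   first one begins at time 0.  The infima are almost surely over nonempty
   sets. *)
Definition first_down (s : R) : R := inf [set t | s <= t /\ xi t = 2%N].
Definition first_up (s : R) : R := inf [set t | s <= t /\ (xi t < 2)%N].

Fixpoint busy_start (j : nat) : R :=
  if j is i.+1 then first_up (first_down (busy_start i)) else 0.

(* Length of the k-th busy period, k >= 1. *)
Definition busy_length (k : nat) : R :=
  first_down (busy_start k.-1) - busy_start k.-1.

End sample_path.

(* Main.v *)
Require Import Defs.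
From HB Require Import structures.
From mathcomp Require Import all_boot all_order all_algebra.
From mathcomp Require Import all_classical all_reals all_analysis.
From mathcomp Require Import measurable_realfun ring lra.

Set Implicit Arguments.
Unset Strict Implicit.
Unset Printing Implicit Defensive.
Import Order.TTheory GRing.Theory Num.Theory.
Import numFieldNormedType.Exports.
Local Open Scope classical_set_scope.
Local Open Scope ring_scope.

(** The state entered at an odd-numbered change of state is always 1, so a path
splits into cycles: cycle m is made of the stay that follows change 2m, in
state 0 or at the end of a repair in state 2, and of the stay in state 1 that
follows change 2m + 1. Let theta_m be the length of the stay in state 0, y_m
that of the stay in state 1, and c_m the indicator that the repair of cycle m
is completed before the operating unit fails. A busy period that starts in
state 0 at cycle m lasts U_m = theta_m + V_m, and one that starts in state 1
lasts V_m = y_m + c_m U_(m+1). The first busy period is a U, every later one is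
a V. As theta_m, the pair (y_m, c_m) and U_(m+1) are independent and c_m is
idempotent, with p = 1 - q the probability of a completed repair,

      E U = E theta + E V            E V = E y + p E U
      E U^2 = E theta^2 + 2 E theta E V + E V^2
      E V^2 = E y^2 + 2 E(y c) E U + p E U^2

and the variances follow by solving this linear system. The gap between the
first busy period and the later ones is the variance of theta, an exponential
time of rate lambda + lambda'.

Finiteness of the moments is not known beforehand, so the system is written for
periods truncated after n cycles, where it is a recursion in n
([from_good_moments], [from_repair_moments], [after_failures_moments]). The
recursion is affine with factor p, and p < 1 because repair times are positive
([repair_completed_lt1]), so the moments converge ([affine_recursion_cvg]).
Almost surely every clock is positive and failures recur ([regular_paths]); on
such a path the infima that define a busy period are attained at changes of
state and the truncated lengths are eventually equal to it ([busy_length1],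
[busy_lengthS]). Monotone convergence then gives the variance
([variance_limit]). The busy periods are computed on a set of probability one
only, and by [integral_null] the integral of an arbitrary function
ignores the null set that is left.

The moments of one cycle come from the layer cake formula
E (int_0^Z h) = int_0^oo h(t) P(Z >= t) dt ([layer_cake]): the tail of y is
exp(- lambda t) (1 - G t), and the integral of that tail is also
E (int_0^eta exp(- lambda t) dt) = q / lambda. Conditioning on the repair time
gives p and E(y c) as integrals against dG. Independence is used in the form
of [integral_indepM]: expectations of functions of disjoint families of clocks
multiply. *)

(** * Independence of functions of disjoint families *)

Section independence.
Local Open Scope ereal_scope.
Context d (T : measurableType d) (R : realType) (P : probability T R).

Definition indep_mfun d1 (T1 : measurableType d1) d2 (T2 : measurableType d2)
    (X : {mfun T >-> T1}) (Y : {mfun T >-> T2}) :=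
  forall A B, measurable A -> measurable B ->
    P (X @^-1` A `&` Y @^-1` B) = P (X @^-1` A) * P (Y @^-1` B).

(** The joint law of X and Y agrees with the product of their laws on rectangles,
hence is that product; Tonelli does the rest. *)
Lemma indep_integral d1 (T1 : measurableType d1) d2 (T2 : measurableType d2)
    (X : {mfun T >-> T1}) (Y : {mfun T >-> T2}) (h : T1 * T2 -> \bar R) :
  indep_mfun X Y -> measurable_fun [set: T1 * T2] h -> (forall z, 0 <= h z) ->
  \int[P]_w h (X w, Y w) =
    \int[distribution P X]_x \int[distribution P Y]_y h (x, y).
Proof.
move=> indXY mh h0.
pose XY : T -> T1 * T2 := fun w => (X w, Y w).
have mXY : measurable_fun setT XY by exact: measurable_fun_pair.
pose XYm := isMeasurableFun.Build _ _ _ _ XY mXY.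
pose XYp : {mfun T >-> (T1 * T2)%type} := HB.pack XY XYm.
rewrite -fubini_tonelli1//.
rewrite -(@ge0_integral_distribution _ _ _ _ _ P XYp h mh h0).
apply: eq_measure_integral => A mA _; apply/esym.
by apply: product_measure_unique.
Qed.

(** For F fixed, the events independent of F form a lambda-system. *)
Lemma indep_generated (G : set (set T)) (F : set T) :
  setI_closed G -> G `<=` measurable -> measurable F ->
  (forall E, G E -> P (E `&` F) = P E * P F) ->
  forall E, <<s G >> E -> P (E `&` F) = P E * P F.
Proof.
move=> GI Gm mF GF E GE.
have sGm : <<s G >> `<=` measurable.
  by apply: smallest_sub => //; exact: sigma_algebra_measurable.
suff: <<s G >> `<=` [set A | measurable A /\ P (A `&` F) = P A * P F].
  by move=> /(_ _ GE)[].
apply: lambda_system_subset; [by []| | |by []].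
- apply/dynkin_lambda_system; split => /=.
  + by rewrite setTI probability_setT mul1e.
  + move=> B [mB PB]; split; first exact: measurableC.
    have -> : P (~` B `&` F) = P F - P (B `&` F).
      rewrite setIC -setDE measureD// 1?[F `&` B]setIC//.
      by rewrite -ge0_fin_numE ?fin_num_measure.
    by rewrite PB probability_setC// muleBl ?mul1e// fin_num_measure.
  + move=> B tB mB; split; first by apply: bigcup_measurable => k _; apply mB.
    rewrite setI_bigcupl measure_bigcup//=; last 2 first.
    * by move=> k _; apply: measurableI => //; apply mB.
    * exact: trivIset_setIr.
    rewrite measure_bigcup//=; last by move=> k _; apply mB.
    rewrite muleC -(fineK (fin_num_measure P F mF)) -nneseriesZl//.
    by apply: eq_eseriesr => k _; rewrite (mB k).2 fineK ?fin_num_measure// muleC.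
- by move=> B GB; split; [exact: Gm|exact: GF].
Qed.

Section disjoint_subfamilies.
Context (I : eqType) (X : I -> {RV P >-> R}).
Hypothesis indepX : mutually_independent X.

(** These events form a pi-system that generates the sigma-algebra of the
variables X i with i in J. *)
Definition cylinders (J : set I) : set (set T) :=
  [set E | exists (s : seq I) (A : I -> set R), [/\ uniq s,
     [set` s] `<=` J, (forall i, measurable (A i)) &
     E = \bigcap_(i in [set` s]) X i @^-1` A i]].

(** The sample space with the coarser sigma-algebra of the variables X i, i in J:
measurability from [subfamily J] says that a function depends on these
variables only, and the closure properties of measurable functions apply. *)
Definition subfamily (J : set I) := g_sigma_algebraType (cylinders J).

Let measurable_preimage i (A : set R) : measurable A -> measurable (X i @^-1` A).
Proof. by move=> mA; rewrite -[X in measurable X]setTI; exact: measurable_funP. Qed.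

Lemma cylinders_measurable J : cylinders J `<=` measurable.
Proof.
move=> _ [s [A [us sJ mA ->]]]; elim: s {us sJ} => [|i s IHs].
  by rewrite (_ : \bigcap_(i in _) _ = setT)// -subTset => w _ i.
rewrite (_ : \bigcap_(i in _) _ =
    X i @^-1` A i `&` \bigcap_(j in [set` s]) X j @^-1` A j).
  by apply: measurableI => //; exact: measurable_preimage.
apply/seteqP; split => [w h|w [wi h] j].
  by split=> [|j js]; apply: h; rewrite /= inE ?eqxx// [j \in s]js orbT.
by rewrite /= inE => /predU1P[->//|]; exact: h.
Qed.

Let cut (s : seq I) (A : I -> set R) i := if i \in s then A i else setT.

(** Constraining a variable to the whole line enlarges the index list freely. *)
Let cylinder_cut (s t : seq I) A : {subset s <= t} ->
  \bigcap_(i in [set` s]) X i @^-1` A i =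
  \bigcap_(i in [set` t]) X i @^-1` cut s A i.
Proof.
move=> st; apply/seteqP; split => w h i /= it.
  by rewrite /cut; case: ifPn => // js; exact: h.
by have := h i (st _ it); rewrite /= /cut it.
Qed.

Let measurable_cut s A : (forall i, measurable (A i)) ->
  forall i, measurable (cut s A i).
Proof. by move=> mA i; rewrite /cut; case: ifPn. Qed.

Lemma cylinders_setI J : setI_closed (cylinders J).
Proof.
move=> _ _ [s [A [us sJ mA ->]]] [t [B [ut tJ mB ->]]].
pose u := undup (s ++ t).
exists u, (fun i => cut s A i `&` cut t B i); split.
- exact: undup_uniq.
- by move=> i /=; rewrite mem_undup mem_cat => /orP[/sJ|/tJ].
- by move=> i; apply: measurableI; exact: measurable_cut.
- rewrite (@cylinder_cut s u) ?(@cylinder_cut t u)//; last 2 first.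
  + by move=> i it; rewrite mem_undup mem_cat it orbT.
  + by move=> i it; rewrite mem_undup mem_cat it.
  rewrite -bigcapI; apply: eq_bigcapr => i _.
  by rewrite preimage_setI.
Qed.

Lemma cylinders_indep (J K : set I) E F : J `&` K = set0 ->
  cylinders J E -> cylinders K F -> P (E `&` F) = P E * P F.
Proof.
move=> JK [s [A [us sJ mA ->]]] [t [B [ut tK mB ->]]].
have st i : i \in s -> i \notin t.
  move=> /sJ Ji; apply/negP => /tK Ki.
  by have : (J `&` K) i by []; rewrite JK.
have ust : uniq (s ++ t).
  rewrite cat_uniq us ut andbT/=; apply/hasPn => i it.
  by apply/negP => /st; rewrite it.
pose C i := if i \in s then A i else B i.
have sC i : i \in s -> C i = A i by rewrite /C => ->.
have tC i : i \in t -> C i = B i.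
  by rewrite /C; case: ifPn => // /st /negbTE ->.
rewrite indepX// indepX//.
rewrite [X in P X](_ : _ = \bigcap_(i in [set` s ++ t]) X i @^-1` C i).
  rewrite indepX//; last by move=> i; rewrite /C; case: ifPn.
  rewrite big_cat/=; congr (_ * _); rewrite big_seq [RHS]big_seq.
    by apply: eq_bigr => i /sC ->.
  by apply: eq_bigr => i /tC ->.
apply/seteqP; split => [w [/= ws wt] i|w h].
  rewrite /= mem_cat => /orP[i_|i_].
    by rewrite sC//; exact: ws.
  by rewrite tC//; exact: wt.
split => i /= i_.
  by rewrite -sC//; apply: h; rewrite /= mem_cat i_.
by rewrite -tC//; apply: h; rewrite /= mem_cat i_ orbT.
Qed.

(** Two applications of the pi-lambda theorem, one in each event. *)
Lemma subfamilies_indep (J K : set I) E F : J `&` K = set0 ->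
  <<s cylinders J >> E -> <<s cylinders K >> F -> P (E `&` F) = P E * P F.
Proof.
move=> JK GE GF.
have mE : measurable E.
  apply: (smallest_sub _ _ GE); last exact: cylinders_measurable.
  exact: sigma_algebra_measurable.
rewrite setIC muleC.
apply: (indep_generated _ _ mE _ GF); first exact: cylinders_setI.
  exact: cylinders_measurable.
move=> F' GF'; rewrite setIC muleC.
apply: (indep_generated _ _ _ _ GE); first exact: cylinders_setI.
- exact: cylinders_measurable.
- exact: cylinders_measurable GF'.
- by move=> E' GE'; exact: (cylinders_indep JK).
Qed.

Lemma subfamily_measurable_id J :
  measurable_fun [set: T] (id : T -> subfamily J).
Proof.
move=> _ A mA; rewrite setTI preimage_id.
apply: (smallest_sub _ _ mA); last exact: cylinders_measurable.
exact: sigma_algebra_measurable.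
Qed.

Lemma subfamily_measurable_proj (J : set I) i : J i ->
  measurable_fun [set: subfamily J] (X i : T -> R).
Proof.
move=> Ji _ A mA; rewrite setTI.
apply: sub_sigma_algebra; exists [:: i], (fun=> A); split => //.
  by move=> j /=; rewrite inE => /eqP ->.
by rewrite set_cons1 bigcap_set1.
Qed.

(** The identity, seen as a pair of variables valued in the two coarser spaces, is
an independent pair. *)
Lemma integral_indepM (J K : set I) (f : subfamily J -> \bar R)
    (g : subfamily K -> \bar R) : J `&` K = set0 ->
  measurable_fun [set: subfamily J] f -> measurable_fun [set: subfamily K] g ->
  (forall w, 0 <= f w) -> (forall w, 0 <= g w) ->
  \int[P]_w (f w * g w) = \int[P]_w f w * \int[P]_w g w.
Proof.
move=> JK mf mg f0 g0.
pose aJ := isMeasurableFun.Build _ _ _ _ _ (@subfamily_measurable_id J).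
pose XJ : {mfun T >-> subfamily J} := HB.pack (id : T -> subfamily J) aJ.
pose aK := isMeasurableFun.Build _ _ _ _ _ (@subfamily_measurable_id K).
pose XK : {mfun T >-> subfamily K} := HB.pack (id : T -> subfamily K) aK.
have XJK : indep_mfun XJ XK.
  by move=> A B mA mB; exact: (subfamilies_indep JK).
pose h (z : subfamily J * subfamily K) := f z.1 * g z.2.
have mh : measurable_fun setT h.
  by apply: emeasurable_funM; exact: measurableT_comp.
rewrite (indep_integral XJK mh); last by move=> z; exact: mule_ge0.
have Eg : \int[distribution P XK]_y g y = \int[P]_w g w.
  exact: (@ge0_integral_distribution _ _ _ _ _ P XK g mg g0).
have Ef : \int[distribution P XJ]_y f y = \int[P]_w f w.
  exact: (@ge0_integral_distribution _ _ _ _ _ P XJ f mf f0).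
rewrite -Ef -Eg -ge0_integralZr//; last exact: integral_ge0.
by apply: eq_integral => x _; rewrite /h/= ge0_integralZl//.
Qed.

End disjoint_subfamilies.

End independence.

(** * Busy periods along one path *)

Section truncated_busy_periods.
Context {R : realType}.
Variables oper standby resid repair : nat -> R.

(** Truncation at 0 makes the durations nonnegative on every path, which the
integrals of nonnegative functions below require; it changes nothing on the
paths with positive clocks. *)
Definition good_stay i : R := Num.max 0 (Num.min (oper i.*2) (standby i.*2)).
Definition repair_stay i : R :=
  Num.max 0 (Num.min (resid i.*2.+1) (repair i.*2.+1)).
Definition fails i : bool := resid i.*2.+1 < repair i.*2.+1.

(** Length of the part, within cycles m to m + n - 1, of a busy period that starts
in state 0 at cycle m. *)
Fixpoint from_good n m : R :=
  if n is n'.+1 then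
    good_stay m + (repair_stay m + (~~ fails m)%:R * from_good n' m.+1)
  else 0.

(** The same for a busy period that starts in state 1 at cycle m. *)
Definition from_repair n m : R :=
  if n is n'.+1 then repair_stay m + (~~ fails m)%:R * from_good n' m.+1
  else 0.

(** Length, within the same n cycles, of the busy period that follows the j-th
failure from cycle m on; for j = 0 it starts in state 1 at cycle m itself. The
outer recursion runs over the failures that remain to be passed, the inner one
over the cycles. *)
Fixpoint after_failures j n m : R :=
  if j is j'.+1 then
    (fix skip n m := if n is n'.+1 then
       (~~ fails m)%:R * skip n' m.+1 + (fails m)%:R * after_failures j' n' m.+1
     else 0) n m
  else from_repair n m.

Lemma after_failuresS j n m : after_failures j.+1 n.+1 m =
  (~~ fails m)%:R * after_failures j.+1 n m.+1
  + (fails m)%:R * after_failures j n m.+1.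
Proof. by []. Qed.

Lemma good_stay_ge0 m : 0 <= good_stay m.
Proof. by rewrite le_max lexx. Qed.

Lemma repair_stay_ge0 m : 0 <= repair_stay m.
Proof. by rewrite le_max lexx. Qed.

Lemma from_good_ge0 n m : 0 <= from_good n m.
Proof.
elim: n m => [//|n IH] m /=.
by rewrite !addr_ge0 ?mulr_ge0 ?good_stay_ge0 ?repair_stay_ge0.
Qed.

Lemma from_good_nd n m : from_good n m <= from_good n.+1 m.
Proof.
elim: n m => [|n IH] m; first exact: from_good_ge0.
by rewrite [leRHS]/= [leLHS]/= !lerD2l ler_wpM2l.
Qed.

Lemma from_repair_ge0 n m : 0 <= from_repair n m.
Proof.
case: n => [//|n] /=.
by rewrite addr_ge0 ?mulr_ge0 ?repair_stay_ge0 ?from_good_ge0.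
Qed.

Lemma from_repair_nd n m : from_repair n m <= from_repair n.+1 m.
Proof.
case: n => [|n]; first exact: from_repair_ge0.
by rewrite [leRHS]/= [leLHS]/= lerD2l ler_wpM2l// from_good_nd.
Qed.

Lemma after_failures_ge0 j n m : 0 <= after_failures j n m.
Proof.
elim: j n m => [|j IHj] n m; first exact: from_repair_ge0.
elim: n m => [//|n IHn] m.
by rewrite after_failuresS addr_ge0// mulr_ge0.
Qed.

Lemma after_failures_nd j n m : after_failures j n m <= after_failures j n.+1 m.
Proof.
elim: j n m => [|j IHj] n m; first exact: from_repair_nd.
elim: n m => [|n IHn] m; first exact: after_failures_ge0.
by rewrite !after_failuresS lerD// ler_wpM2l// ?IHn ?IHj.
Qed.

End truncated_busy_periods.

Section paths.
Context {R : realType}.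
Variables oper standby resid repair : nat -> R.
Hypotheses (oper_gt0 : forall n, 0 < oper n)
  (standby_gt0 : forall n, 0 < standby n)
  (resid_gt0 : forall n, 0 < resid n) (repair_gt0 : forall n, 0 < repair n).

Local Notation config := (config_after oper standby resid repair).
Local Notation time := (jump_time oper standby resid repair).
Local Notation state := (jump_state oper standby resid repair).
Local Notation xi := (xi oper standby resid repair).
Local Notation fails := (fails resid repair).
Local Notation good_stay := (good_stay oper standby).
Local Notation repair_stay := (repair_stay resid repair).
Local Notation from_good := (from_good oper standby resid repair).
Local Notation from_repair := (from_repair oper standby resid repair).
Local Notation after_failures := (after_failures oper standby resid repair).

(** A change of state out of 0 or 2 leads to 1, and one out of 1 leads to 0 or 2. *)
Lemma state_even_odd m :
  state m.*2 = (if m is i.+1 then if fails i then 2 else 0 else 0)%N /\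
  state m.*2.+1 = 1%N.
Proof.
have next i : state i.*2 = 0%N \/ state i.*2 = 2%N -> state i.*2.+1 = 1%N.
  rewrite /jump_state /=; case: (config i.*2) => [[t s] r] /=.
  by move=> [->|->].
elim: m => [|m [_ IH]]; first by split=> //; apply: next; left.
have E : state m.+1.*2 = (if fails m then 2 else 0)%N.
  move: IH; rewrite doubleS /jump_state /fails /=.
  case: (step _ _ _ _ m.*2 _) => [[t s] r] /= -> /=.
  by case: ifP.
split=> //; apply: next; rewrite E; case: ifP; by [right|left].
Qed.

Lemma time_good_stay m : state m.*2 = 0%N ->
  time m.*2.+1 = time m.*2 + good_stay m.
Proof.
rewrite /jump_state /jump_time /=; case: (config m.*2) => [[t s] r] /= ->.
by rewrite /= /good_stay max_r// ltW// lt_min oper_gt0 standby_gt0.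
Qed.

Lemma time_repair_stay m : time m.*2.+2 = time m.*2.+1 + repair_stay m.
Proof.
have [_] := state_even_odd m; rewrite /jump_state /jump_time /=.
case: (step _ _ _ _ m.*2 _) => [[t s] r] /= ->.
rewrite /= /repair_stay max_r; last by rewrite ltW// lt_min resid_gt0 repair_gt0.
by case: ltP.
Qed.

Lemma time_lt_succ n : time n < time n.+1.
Proof.
have inv : (config n).1.2 = 2%N -> 0 < (config n).2.
  case: n => [//|n] /=; case: (config n) => [[t [|[|s]]] r] //=.
  by case: ifP => //=; rewrite subr_gt0.
move: inv; rewrite /jump_time /=.
have sn : ((config n).1.2 <= 2)%N.
  case: n => [//|n] /=; case: (config n) => [[t [|[|s]]] r] //=.
  by case: ifP.
case: (config n) sn => [[t [|[|[|s]]]] r] //= _ h.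
- by rewrite ltrDl lt_min oper_gt0 standby_gt0.
- by case: ifP => _ /=; rewrite ltrDl.
- by rewrite ltrDl h.
Qed.

Lemma le_time m n : (time m <= time n) = (m <= n)%N.
Proof. by have /increasing_seqP := time_lt_succ; exact. Qed.

Lemma lt_time m n : (time m < time n) = (m < n)%N.
Proof. by rewrite ltNge le_time -ltnNge. Qed.

Lemma xi_stay n t : time n <= t < time n.+1 -> xi t = state n.
Proof.
move=> /andP[nt tn]; rewrite /xi; congr jump_state.
have : exists k, time k <= t < time k.+1 by exists n; rewrite nt.
move=> /(xgetPex 0%N) /=; set k := xget _ _ => /andP[kt tk].
apply/eqP; rewrite eqn_leq; apply/andP; split; rewrite -ltnS -lt_time.
  exact: le_lt_trans kt tn.
exact: le_lt_trans nt tk.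
Qed.

Lemma time_locate m n t : time m <= t < time n ->
  exists2 k, (m <= k < n)%N & time k <= t < time k.+1.
Proof.
elim: n => [|n IH] /andP[mt tn].
  by have := le_lt_trans mt tn; rewrite lt_time.
have [tn'|nt] := ltP t (time n).
  have [|k /andP[mk kn] kt] := IH; first by rewrite mt.
  by exists k => //; rewrite mk ltnW.
exists n; last by rewrite nt.
by rewrite ltnSn andbT -ltnS -lt_time (le_lt_trans mt).
Qed.

(** The infimum is a minimum, attained at the n-th change of state. *)
Lemma inf_entrance (Q : nat -> Prop) m n : (m <= n)%N -> Q (state n) ->
  (forall k, (m <= k < n)%N -> ~ Q (state k)) ->
  inf [set t | time m <= t /\ Q (xi t)] = time n.
Proof.
move=> mn Qn nQ; set A := [set t | _].
have An : A (time n).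
  by split; [rewrite le_time|rewrite (@xi_stay n)// lexx time_lt_succ].
have lbA : lbound A (time n).
  move=> t [mt Qt]; rewrite leNgt; apply/negP => tn.
  have [|k mkn kt] := @time_locate m n t; first by rewrite mt.
  by apply: (nQ k mkn); rewrite -(xi_stay kt).
apply/eqP; rewrite eq_le; apply/andP; split.
  by apply: ge_inf => //; exists (time n).
by apply: lb_le_inf => //; exists (time n).
Qed.

Hypothesis fails_io : forall m, exists i, (m <= i)%N && fails i.

Definition next_failure m : nat := ex_minn (fails_io m).

Lemma next_failureP m : (m <= next_failure m)%N /\ fails (next_failure m) /\
  forall i, (m <= i < next_failure m)%N -> ~~ fails i.
Proof.
rewrite /next_failure; case: ex_minnP => k /andP[mk fk] kmin.
split=> //; split=> // i /andP[mi ik]; apply/negP => fi.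
by have := kmin i; rewrite mi fi => /(_ isT); rewrite leqNgt ik.
Qed.

Lemma next_failure_step m : next_failure m =
  if fails m then m else next_failure m.+1.
Proof.
have [mk [fk kmin]] := next_failureP m.
have [mk' [fk' kmin']] := next_failureP m.+1.
case: ifPn => fm.
  apply/eqP; rewrite eqn_leq mk andbT leqNgt; apply/negP => mlt.
  by have := kmin m; rewrite leqnn mlt fm => /(_ isT).
apply/eqP; rewrite eqn_leq; apply/andP; split; rewrite leqNgt; apply/negP => h.
  by have := kmin (next_failure m.+1); rewrite h (ltnW mk') fk' => /(_ isT).
have := kmin' (next_failure m); rewrite h fk andbT => H.
have mk2 : (m < next_failure m)%N.
  by rewrite ltn_neqAle mk andbT; apply: contraNneq fm => ->.
by have := H mk2.
Qed.

Lemma first_down_good m : state m.*2 = 0%N ->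
  first_down oper standby resid repair (time m.*2) =
  time (next_failure m).*2.+2.
Proof.
move=> m0; have [mk [fk kmin]] := next_failureP m.
apply: (@inf_entrance (fun s => s = 2%N)).
- by rewrite -doubleS leq_double leqW.
- by rewrite -doubleS (state_even_odd _).1 fk.
move=> k /andP[]; rewrite -(odd_double_half k).
case: (odd k); rewrite ?add1n ?add0n; first by rewrite (state_even_odd _).2.
rewrite leq_double -doubleS ltn_double ltnS => mk' kk.
have [->|mk2] := eqVneq k./2 m; first by rewrite m0.
have : (m < k./2)%N by rewrite ltn_neqAle eq_sym mk2.
rewrite (state_even_odd _).1; case: k./2 kk {mk' mk2} => [//|i] ik mi.
by rewrite (negbTE (kmin i _))// -ltnS mi.
Qed.

Lemma first_down_repair m :
  first_down oper standby resid repair (time m.*2.+1) =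
  time (next_failure m).*2.+2.
Proof.
have [mk [fk kmin]] := next_failureP m.
apply: (@inf_entrance (fun s => s = 2%N)).
- by rewrite ltnS leqW// leq_double.
- by rewrite -doubleS (state_even_odd _).1 fk.
move=> k /andP[]; rewrite -(odd_double_half k).
case: (odd k); rewrite ?add1n ?add0n; first by rewrite (state_even_odd _).2.
rewrite ltn_double -doubleS ltn_double ltnS => mk' kk.
rewrite (state_even_odd _).1; case: k./2 kk mk' => [//|i] ik mi.
by rewrite (negbTE (kmin i _))// -ltnS mi.
Qed.

Lemma first_up_failure i : fails i ->
  first_up oper standby resid repair (time i.*2.+2) = time i.*2.+3.
Proof.
move=> fi; apply: (@inf_entrance (fun s => (s < 2)%N)) => //.
  by rewrite -doubleS (state_even_odd _).2.
move=> k; rewrite ltnS => /anti_leq <-.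
by rewrite -doubleS (state_even_odd _).1 fi.
Qed.

Let restart m := (next_failure m).+1.

(** The (k + 1)-th failure ends a busy period at the end of its cycle; the stay in
state 2 opens the next cycle, and the next busy period starts in the middle of
that cycle, on entering state 1. *)
Lemma busy_start_restart k :
  busy_start oper standby resid repair k.+1 = time (iter k.+1 restart 0%N).*2.+1.
Proof.
elim: k => [|k IH].
  rewrite /= (_ : 0 = time 0%N.*2)// first_down_good// first_up_failure//.
  by case: (next_failureP 0) => _ [].
rewrite [LHS]/= -/(busy_start _ _ _ _ k.+1) IH first_down_repair.
by rewrite first_up_failure//; case: (next_failureP (iter k.+1 restart 0%N)) => _ [].
Qed.

Lemma from_good_stable n m : (next_failure m < n + m)%N -> state m.*2 = 0%N ->
  from_good n m = time (next_failure m).*2.+2 - time m.*2.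
Proof.
elim: n m => [|n IH] m; first by rewrite ltnNge; case: (next_failureP m) => ->.
rewrite next_failure_step => + m0 /=; case: ifPn => fm h /=.
  by rewrite mul0r addr0 time_repair_stay time_good_stay//; lra.
rewrite mul1r IH; last 2 first.
- by rewrite addnS.
- by rewrite (state_even_odd _).1 (negbTE fm).
by rewrite doubleS (time_repair_stay m) (time_good_stay m0); lra.
Qed.

Lemma from_repair_stable n m : (next_failure m < n + m)%N ->
  from_repair n m = time (next_failure m).*2.+2 - time m.*2.+1.
Proof.
case: n => [|n]; first by rewrite ltnNge; case: (next_failureP m) => ->.
rewrite next_failure_step; case: ifPn => fm h /=; rewrite fm /=.
  by rewrite mul0r addr0 time_repair_stay; lra.
rewrite mul1r from_good_stable; last 2 first.
- by rewrite addnS.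
- by rewrite (state_even_odd _).1 (negbTE fm).
by rewrite doubleS (time_repair_stay m); lra.
Qed.

(** Double induction: on the failures to be passed, and for each of them on the
number of cycles before it. *)
Lemma after_failures_stable j m : exists N, forall n, (N <= n)%N ->
  after_failures j n m = time (next_failure (iter j restart m)).*2.+2
    - time (iter j restart m).*2.+1.
Proof.
elim: j m => [|j IHj] m.
  exists (next_failure m).+1 => n h.
  by rewrite -(@from_repair_stable n m)// ltn_addr.
have [k] := ubnP (next_failure m - m)%N; elim: k m => // k IHk m.
have [mk [fk kmin]] := next_failureP m.
move=> hk; have := next_failure_step m; case: ifPn => [fm E|fm E].
  have [N hN] := IHj m.+1; exists N.+1 => -[//|n] Nn.
  rewrite after_failuresS fm mul0r add0r mul1r hN//.
  by rewrite iterSr /restart E.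
have [|N hN] := IHk m.+1.
  move: hk; rewrite E; have [+ _] := next_failureP m.+1.
  by move=> h; rewrite subnS; case: (_ - m)%N (subn_gt0 m (next_failure m.+1)) => [|i]//=; rewrite h.
exists N.+1 => -[//|n] Nn.
rewrite after_failuresS fm (negbTE fm) mul0r addr0 mul1r hN//.
by rewrite !iterSr /restart E.
Qed.

Lemma busy_length1 : exists N, forall n, (N <= n)%N ->
  from_good n 0 = busy_length oper standby resid repair 1.
Proof.
exists (next_failure 0).+1 => n h.
rewrite from_good_stable ?addn0//.
by rewrite /busy_length /= (_ : 0 = time 0%N.*2)// first_down_good.
Qed.

Lemma busy_lengthS k : exists N, forall n, (N <= n)%N ->
  after_failures k.+1 n 0 = busy_length oper standby resid repair k.+2.
Proof.
have [N hN] := after_failures_stable k.+1 0; exists N => n /hN ->.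
by rewrite /busy_length [k.+2.-1]/= busy_start_restart first_down_repair.
Qed.

End paths.

(** * Exponential integrals *)

Section exponential_integrals.
Context {R : realType}.
Lemma cvg_expRM (r : R) : 0 < r -> expR (- r * x) @[x --> +oo] --> (0 : R).
Proof.
move=> r0; rewrite (_ : (fun x => expR (- r * x)) =
             (fun z => expR (- z)) \o (fun z => r * z)); last first.
  by apply: eq_fun => x; rewrite mulNr.
apply: (@cvg_comp _ _ _ _ _ _ (pinfty_nbhs R)); last exact: cvgr_expR.
exact: gt0_cvgMry.
Qed.

Variable r : R.
Hypothesis r0 : 0 < r.
Let mu := @lebesgue_measure R.

Lemma continuous_expRM : continuous (fun x : R => expR (- r * x)).
Proof.
move=> z; apply: continuous_comp; last exact: continuous_expR.
by apply: continuousM => //; exact: cst_continuous.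
Qed.

Lemma measurable_expRM D : measurable_fun D (fun x : R => expR (- r * x)).
Proof.
apply: measurable_funTS; apply: continuous_measurable_fun.
exact: continuous_expRM.
Qed.

Lemma is_derive_expRM (x : R) :
  is_derive x 1 (fun x : R => expR (- r * x)) (- r * expR (- r * x)).
Proof.
have d1 : is_derive x (1 : R) ((- r) \*: (@id R)) ((- r) *: (1 : R)) by exact: is_deriveZ.
have := @is_derive1_comp R _ _ x _ _ (is_derive_expR _) d1.
by rewrite /= /GRing.scale/= mulr1 mulrC; exact.
Qed.

Lemma integral_itvcy (f F : R -> R) t l : (forall x, t <= x -> 0 <= f x) ->
  continuous f -> F x @[x --> +oo] --> l ->
  (forall x : R, is_derive x 1 F (f x)) ->
  (\int[mu]_(x in `[t, +oo[) (f x)%:E = (l - F t)%:E)%E.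
Proof.
move=> f0 cf Fl dF; rewrite EFinB.
apply: (@ge0_continuous_FTC2y _ _ F) => //.
- exact: continuous_subspaceT.
- apply: cvg_at_right_filter.
  apply: differentiable_continuous; apply/derivable1_diffP.
  by have [] := dF t.
- by move=> x _; rewrite derive1E; have [] := dF x.
Qed.

Lemma integral_expR_itvcy t :
  (\int[mu]_(x in `[t, +oo[) (expR (- r * x))%:E = (expR (- r * t) / r)%:E)%E.
Proof.
pose F x : R := - r^-1 * expR (- r * x).
have dF (x : R) : is_derive x 1 F (expR (- r * x)).
  apply: (is_derive_eq (@is_deriveZ _ _ _ _ (- r^-1) x _ _ (is_derive_expRM x))).
  by rewrite /GRing.scale/= mulrA mulrNN mulVf ?mul1r// gt_eqF.
have F0 : F x @[x --> +oo] --> (0 : R).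
  by rewrite -(mulr0 (- r^-1)); apply: cvgMr; exact: cvg_expRM r0.
rewrite (integral_itvcy _ _ F0 dF).
- by rewrite sub0r /F mulNr opprK mulrC.
- by move=> x _; exact: expR_ge0.
- exact: continuous_expRM.
Qed.

(** Since x <= (2 / r) exp(r x / 2), half of the exponential absorbs x. *)
Lemma cvg_idM_expRM : (x * expR (- r * x)) @[x --> +oo] --> (0 : R).
Proof.
have h : (2 / r) * expR (- (r / 2) * x) @[x --> +oo] --> (0 : R).
  by rewrite -(mulr0 (2 / r)); apply: cvgMr; apply: cvg_expRM; rewrite divr_gt0.
apply: (squeeze_cvgr _ (cvg_cst 0) h).
near=> x.
have x0 : 0 <= x by near: x; exact: nbhs_pinfty_ge.
rewrite mulr_ge0 ?expR_ge0//=.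
have -> : - r * x = - (r / 2) * x + - (r / 2) * x by field.
rewrite expRD mulrA ler_pM2r ?expR_gt0//.
rewrite -ler_pdivlMr ?expR_gt0// -expRN -mulNr opprK.
have := expR_ge1Dx (r / 2 * x); set e := expR _ => h1.
rewrite mulrAC ler_pdivlMr// mulrC.
have -> : r * x = 2 * (r / 2 * x) by field.
by rewrite ler_pM2l//; apply: le_trans h1; rewrite lerDr.
Unshelve. all: by end_near. Qed.

Lemma integral_idM_expR :
  (\int[mu]_(x in `[0%R, +oo[) (x * expR (- r * x))%:E = (r ^- 2)%:E)%E.
Proof.
pose F x : R := (- r^-1 * x + - r ^- 2) * expR (- r * x).
have dF (x : R) : is_derive x 1 F (x * expR (- r * x)).
  have dl : is_derive x (1 : R) (fun x : R => - r^-1 * x + - r ^- 2) (- r^-1).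
    apply: (is_derive_eq (@is_deriveD _ _ _ _ _ x _ _ _
      (@is_deriveZ _ _ _ _ (- r^-1) x _ _ (is_derive_id x (1:R)))
      (is_derive_cst (- r ^- 2) x (1:R)))).
    by rewrite /GRing.scale/= mulr1 addr0.
  apply: (is_derive_eq (is_deriveM dl (is_derive_expRM x))).
  rewrite /GRing.scale/=; field.
  by rewrite gt_eqF.
have F0 : F x @[x --> +oo] --> (0 : R).
  rewrite (_ : F = fun x => - r^-1 * (x * expR (- r * x)) + - r ^- 2 * expR (- r * x)).
    rewrite [X in _ --> X](_ : 0 = - r^-1 * 0 + - r ^- 2 * 0); last by ring.
    by apply: cvgD; apply: cvgMr; [exact: cvg_idM_expRM|exact: cvg_expRM r0].
  by apply/funext => x; rewrite /F mulrDl mulrA.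
rewrite (integral_itvcy _ _ F0 dF).
- by rewrite /F !mulr0 add0r expR0 mulr1 sub0r opprK.
- by move=> x x0; rewrite mulr_ge0// expR_ge0.
- by move=> x; apply: cvgM; [exact: cvg_id|exact: continuous_expRM].
Qed.

End exponential_integrals.

Section primitives.
Context {R : realType}.
Let mu := @lebesgue_measure R.

Lemma integral_itv0c (f F : R -> R) z : 0 <= z -> continuous f ->
  (forall x : R, is_derive x 1 F (f x)) ->
  (\int[mu]_(x in `[0%R, z]) (f x)%:E = (F z - F 0)%:E)%E.
Proof.
rewrite le_eqVlt => /predU1P[<- _ _|z0 cf dF].
  by rewrite set_itv1 integral_set1 subrr.
have cF : continuous F.
  move=> x; apply: differentiable_continuous; apply/derivable1_diffP.
  by have [] := dF x.
rewrite EFinB; apply: (@continuous_FTC2 _ _ F) => //.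
- exact: continuous_subspaceT.
- split; [by move=> x _; have [] := dF x| |].
    exact/cvg_at_right_filter/cF.
  exact/cvg_at_left_filter/cF.
- by move=> x _; rewrite derive1E; have [] := dF x.
Qed.

Lemma integral_itv0c_cst1 (z : R) : 0 <= z ->
  (\int[mu]_(x in `[0%R, z]) 1%:E = z%:E)%E.
Proof.
move=> z0; rewrite (@integral_itv0c (fun=> 1) id)// ?subr0//.
by move=> x; exact: cst_continuous.
Qed.

Lemma integral_itv0c_double (z : R) : 0 <= z ->
  (\int[mu]_(x in `[0%R, z]) (2 * x)%:E = (z ^+ 2)%:E)%E.
Proof.
move=> z0; have dF (x : R) : is_derive x (1 : R) (fun x : R => x ^+ 2) (2 * x).
  apply: (is_derive_eq (is_deriveX 2 (is_derive_id x (1 : R)))).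
  by rewrite /GRing.scale/= mulr1 expr1 mulr_natl.
rewrite (integral_itv0c z0 _ dF) ?expr0n ?subr0//.
by move=> x; apply: cvgMr; exact: cvg_id.
Qed.

Lemma integral_itv0c_expR (r z : R) : 0 < r -> 0 <= z ->
  (\int[mu]_(x in `[0%R, z]) (expR (- r * x))%:E = ((1 - expR (- r * z)) / r)%:E)%E.
Proof.
move=> r0 z0; pose F x : R := - r^-1 * expR (- r * x).
have dF (x : R) : is_derive x 1 F (expR (- r * x)).
  apply: (is_derive_eq (@is_deriveZ _ _ _ _ (- r^-1) x _ _ (is_derive_expRM r x))).
  by rewrite /GRing.scale/= mulrA mulrNN mulVf ?mul1r// gt_eqF.
rewrite (integral_itv0c z0 _ dF).
  by congr EFin; rewrite /F mulr0 expR0; ring.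
exact: continuous_expRM.
Qed.

End primitives.

(** * Tail integrals and the laws of the clocks *)

Section tail_integrals.
Local Open Scope ereal_scope.
Context d (T : measurableType d) (R : realType) (P : probability T R).
Let mu : {measure set _ -> \bar R} := @lebesgue_measure R.

Lemma measurable_le_fun d' (S : measurableType d') (f g : S -> R) :
  measurable_fun setT f -> measurable_fun setT g ->
  measurable [set w | (f w <= g w)%R].
Proof.
move=> mf mg; have := measurable_fun_ler mf mg.
by move=> /(_ measurableT [set true]); rewrite setTI; exact.
Qed.

Lemma measurable_lt_fun d' (S : measurableType d') (f g : S -> R) :
  measurable_fun setT f -> measurable_fun setT g ->
  measurable [set w | (f w < g w)%R].
Proof.
move=> mf mg; have := measurable_fun_ltr mf mg.
by move=> /(_ measurableT [set true]); rewrite setTI; exact.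
Qed.

(** Tonelli on the region 0 <= x <= Z w. *)
Lemma layer_cake (Z : T -> R) (h : R -> R) :
  measurable_fun setT Z -> measurable_fun setT h ->
  (forall x, (0 <= x)%R -> (0 <= h x)%R) ->
  \int[P]_w \int[mu]_(x in `[0%R, Z w]) (h x)%:E =
  \int[mu]_(x in `[0%R, +oo[) ((h x)%:E * P [set w | (x <= Z w)%R]).
Proof.
move=> mZ mh h0.
pose GR := measurableTypeR R.
pose D : set (T * GR) := [set p | (0 <= p.2)%R] `&` [set p | (p.2 <= Z p.1)%R].
pose f (p : T * GR) : \bar R := (h p.2 * \1_D p)%:E.
have mD : measurable D.
  apply: measurableI; apply: measurable_le_fun => //.
  exact: (measurableT_comp mZ).
have mf : measurable_fun setT f.
  apply/measurable_EFinP; apply: measurable_funM.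
    exact: (measurableT_comp mh).
  exact: measurable_indic.
have f0 p : 0 <= f p.
  rewrite /f lee_fin indicE; case: (boolP (p \in D)) => [|_].
    by rewrite inE => -[/= p0 _]; rewrite mulr1 h0.
  by rewrite mulr0.
have := @fubini_tonelli _ _ _ _ _ P mu f mf f0.
rewrite /fubini_F /fubini_G => E.
transitivity (\int[P]_w \int[mu]_x f (w, x)).
  apply: eq_integral => w _; rewrite integral_mkcond.
  apply: eq_integral => x _; rewrite patchE /f /= indicE.
  have -> : ((w, x) \in D) = (x \in `[0%R, Z w]%classic).
    by apply/idP/idP; rewrite !inE /D /= in_itv /= => /andP.
  by case: ifP => _; rewrite ?mulr1 ?mulr0.
rewrite E [RHS]integral_mkcond; apply: eq_integral => x _.
rewrite patchE; case: ifPn => [|]; rewrite ?notin_setE ?inE/= in_itv/= andbT => x0.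
  rewrite /f /=; under eq_integral do rewrite EFinM.
  rewrite ge0_integralZl//; last 2 first.
  - apply/measurable_EFinP.
    rewrite (_ : (fun y => _) = \1_[set w | (x <= Z w)%R]).
      exact/measurable_indic/measurable_le_fun.
    apply/funext => w; rewrite !indicE; congr (_%:R); congr nat_of_bool.
    by apply/idP/idP; rewrite !inE /D /= ?x0 // => -[].
  - by rewrite lee_fin h0.
  congr (_ * _).
  transitivity (\int[P]_w (\1_[set w | (x <= Z w)%R] w)%:E); last first.
    by rewrite integral_indic ?setIT//; exact: measurable_le_fun.
  apply: eq_integral => w _; rewrite !indicE; congr (_%:R%:E); congr nat_of_bool.
  by apply/idP/idP; rewrite !inE /D /= ?x0 // => -[].
apply: integral0_eq => w _; rewrite /f /= indicE memNset ?mulr0//.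
by rewrite /D /= => -[].
Qed.

End tail_integrals.

Section clock_laws.
Local Open Scope ereal_scope.
Context d (T : measurableType d) (R : realType) (P : probability T R).
Let mu : {measure set _ -> \bar R} := @lebesgue_measure R.

Lemma exponential_RV_ge (r : R) (X : {RV P >-> R}) t : (0 < r)%R ->
  exponential_RV r X -> (0 <= t)%R ->
  P [set w | (t <= X w)%R] = (expR (- r * t))%:E.
Proof.
move=> r0 Xexp t0; have := Xexp `[t, +oo[%classic.
rewrite /distribution /pushforward => /(_ (measurable_itv _)).
rewrite (_ : X @^-1` _ = [set w | (t <= X w)%R]); last first.
  by apply/seteqP; split=> w /=; rewrite in_itv/= andbT.
move=> ->; rewrite /exponential_prob.
transitivity (\int[mu]_(x in `[t, +oo[) (r%:E * (expR (- r * x))%:E)).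
  apply: eq_integral => x; rewrite inE/= in_itv/= andbT => tx.
  by rewrite exponential_pdfE// (le_trans t0).
rewrite ge0_integralZl//.
- by rewrite integral_expR_itvcy// -EFinM mulrCA mulfV ?mulr1// gt_eqF.
- by apply/measurable_EFinP; exact: measurable_expRM.
- by rewrite lee_fin ltW.
Qed.

Lemma exponential_RV_gt0 (r : R) (X : {RV P >-> R}) : (0 < r)%R ->
  exponential_RV r X -> {ae P, forall w, (0 < X w)%R}.
Proof.
move=> r0 Xexp; have mX := measurable_funP X.
exists [set w | (X w <= 0)%R]; split.
- exact: measurable_le_fun.
- have := Xexp `]-oo, 0%R]%classic.
  rewrite /distribution /pushforward => /(_ (measurable_itv _)).
  rewrite (_ : X @^-1` _ = [set w | (X w <= 0)%R]); last first.
    by apply/seteqP; split=> w /=; rewrite in_itv/=.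
  move=> ->; rewrite /exponential_prob.
  rewrite -integral_itv_bndo_bndc; last first.
    by apply/measurable_EFinP/measurable_funTS; exact: measurable_exponential_pdf.
  apply: integral0_eq => x /=; rewrite in_itv/= => x0.
  by rewrite lt0_exponential_pdf.
- by move=> w /negP; rewrite -leNgt.
Qed.

Section repair_time.
Variables (G : distrFun R) (eta : {RV P >-> R}).
Hypothesis eta_G : forall t, P [set w | (eta w < t)%R] = (G t)%:E.
Hypothesis G0 : G x @[x --> (0:R)%R^'+] --> (0 : R)%R.

Lemma distrFun_ge0 t : (0 <= G t)%R.
Proof. by rewrite -lee_fin -eta_G. Qed.

Lemma distrFun_le0 t : (t <= 0)%R -> G t = 0%R.
Proof.
move=> t0; apply/eqP; rewrite eq_le distrFun_ge0 andbT.
rewrite -(cvg_lim (@Rhausdorff R) G0); apply: limr_ge.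
  by apply/cvg_ex; exists 0%R; exact: G0.
near=> x; apply: df_nondecreasing; rewrite (le_trans t0)// ltW//.
Unshelve. all: by end_near. Qed.

Lemma repair_ge t : P [set w | (t <= eta w)%R] = (1 - G t)%:E.
Proof.
rewrite (_ : [set w | _] = ~` [set w | (eta w < t)%R]); last first.
  by apply/seteqP; split=> w /=; rewrite leNgt => /negP.
rewrite probability_setC ?eta_G//.
exact: (measurable_lt_fun (measurable_funP eta)).
Qed.

(** P(eta <= 0) <= P(eta < x) = G x for all x > 0, and G(0+) = 0. *)
Lemma repair_gt0 : {ae P, forall w, (0 < eta w)%R}.
Proof.
have meta := measurable_funP eta.
exists [set w | (eta w <= 0)%R]; split.
- exact: measurable_le_fun.
- apply/eqP; rewrite eq_le measure_ge0 andbT.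
  apply/lee_addgt0Pr => e e0; rewrite add0e.
  have : \forall x \near (0:R)%R^'+, (G x <= e)%R.
    near=> x; apply: le_trans (_ : `|0 - G x| <= e)%R.
      by rewrite sub0r normrN ger0_norm// distrFun_ge0.
    by near: x; move/cvgrPdist_le : G0; apply.
  move=> He; near (0:R)%R^'+ => x.
  rewrite (@le_trans _ _ (G x)%:E)//; last by rewrite lee_fin; near: x.
  rewrite -eta_G le_measure ?inE//.
  + exact: measurable_le_fun.
  + exact: measurable_lt_fun.
  + by move=> w /= /le_lt_trans; apply; near: x; exact: nbhs_right_gt.
- by move=> w /negP; rewrite -leNgt.
Unshelve. all: by end_near. Qed.

(** The events eta < t + 1/(n + 1) decrease to eta <= t. *)
Lemma repair_le t : P [set w | (eta w <= t)%R] = (right_limit G t)%:E.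
Proof.
have meta := measurable_funP eta.
pose A n := [set w | (eta w < t + n.+1%:R^-1)%R].
have mA n : measurable (A n) by exact: measurable_lt_fun.
have AE : [set w | (eta w <= t)%R] = \bigcap_n A n.
  apply/seteqP; split=> [w /= wt n _|w /= Aw].
    by rewrite /A/= (le_lt_trans wt)// ltrDl invr_gt0.
  apply/ler_addgt0Pr => e e0.
  have [n ne] := ltr_add_invr (y := t) (x := t + e) ltac:(by rewrite ltrDl).
  exact: le_trans (ltW (Aw n I)) (ltW ne).
have c1 : P (A n) @[n --> \oo] --> P [set w | (eta w <= t)%R].
  rewrite AE; apply: nonincreasing_cvg_mu => //.
  - by rewrite -ge0_fin_numE ?fin_num_measure.
  - exact: bigcapT_measurable.
  - move=> m n mn; apply/subsetPset => w; rewrite /A/= => /lt_le_trans; apply.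
    by rewrite lerD2l lef_pV2 ?posrE// ler_nat.
have c2 : P (A n) @[n --> \oo] --> (right_limit G t)%:E.
  rewrite (_ : (fun n => P (A n)) = EFin \o (fun n => G (t + n.+1%:R^-1)%R)).
    apply: cvg_EFin; first by near=> n.
    have /cvg_at_rightP := @right_limit_cvg R G t; apply; split.
      by move=> n; rewrite ltrDl invr_gt0.
    rewrite -[X in _ --> X]addr0; apply: cvgD; first exact: cvg_cst.
    exact: cvg_harmonic.
  by apply/funext => n; rewrite /A eta_G.
exact: cvg_unique c1 c2.
Unshelve. all: by end_near. Qed.

(** Both measures give G(b+) - G(a+) to the interval ]a, b]. *)
Lemma repair_preimage A : measurable A -> P (eta @^-1` A) = stieltjes G A.
Proof.
move=> mA; apply/esym.
pose meta := isMeasurableFun.Build _ _ T (measurableTypeR R) eta (measurable_funP eta).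
pose eta' : {mfun T >-> measurableTypeR R} := HB.pack (eta : T -> measurableTypeR R) meta.
pose nu : {measure set (measurableTypeR R) -> \bar R} := distribution P eta'.
pose F : cumulative R R := right_limit G.
apply: (@lebesgue_stieltjes_measure_unique R F nu _ A mA).
move=> _ [[a b] _ <-] /=.
rewrite /lebesgue_stieltjes_measure /measure_extension/=.
rewrite measurable_mu_extE/=; last exact: is_ocitv.
have [ab | ba] := leP a b; last first.
  by rewrite set_itv_ge ?wlength0 ?measure0// bnd_simp -leNgt ltW.
rewrite wlength_itv_bnd// EFinB -!repair_le /nu /distribution /pushforward.
rewrite (_ : eta' @^-1` _ = [set w | (eta w <= b)%R] `\` [set w | (eta w <= a)%R]).
  rewrite measureD ?setIidr//; try exact: (measurable_le_fun (measurable_funP eta)).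
    by move=> w /= /le_trans; apply.
  by rewrite -ge0_fin_numE ?fin_num_measure//; exact: (measurable_le_fun (measurable_funP eta)).
apply/seteqP; split => w /=; rewrite in_itv/=.
  by move=> /andP[aw wb]; split=> //; rewrite leNgt aw.
by move=> [wb /negP]; rewrite -ltNge => ->.
Qed.

Lemma ge0_integral_repair (f : R -> \bar R) :
  measurable_fun [set: R] f -> (forall y, 0 <= f y) ->
  \int[P]_w f (eta w) = \int[stieltjes G]_y f y.
Proof.
move=> mf f0.
pose meta := isMeasurableFun.Build _ _ T (measurableTypeR R) eta (measurable_funP eta).
pose eta' : {mfun T >-> measurableTypeR R} := HB.pack (eta : T -> measurableTypeR R) meta.
rewrite -(@ge0_integral_distribution _ _ T (measurableTypeR R) R P eta' f)//.
by apply: eq_measure_integral => A mA _; exact: repair_preimage.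
Qed.

End repair_time.

End clock_laws.

(** * Moments of one cycle *)

Section cycle_moments.
Local Open Scope ereal_scope.
Context d (T : measurableType d) (R : realType) (P : probability T R).
Let mu : {measure set _ -> \bar R} := @lebesgue_measure R.

Local Notation minp X Y := (fun w => Num.max 0%R (Num.min (X w) (Y w))).

Let measurable_minp (X Y : {RV P >-> R}) : measurable_fun setT (minp X Y).
Proof. by apply: measurable_maxr => //; exact: measurable_minr. Qed.

(** At x = 0 the truncation makes the event certain, which is where the values of
SX and SY at 0 are needed. *)
Lemma min_tail (X Y : {RV P >-> R}) (SX SY : R -> R) x :
  indep_mfun P X Y ->
  (forall t, (0 <= t)%R -> P [set w | (t <= X w)%R] = (SX t)%:E) ->
  (forall t, (0 <= t)%R -> P [set w | (t <= Y w)%R] = (SY t)%:E) ->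
  SX 0%R = 1%R -> SY 0%R = 1%R -> (0 <= x)%R ->
  P [set w | (x <= Num.max 0 (Num.min (X w) (Y w)))%R] = (SX x * SY x)%:E.
Proof.
move=> XY SXE SYE SX0 SY0; rewrite le_eqVlt => /predU1P[<-|x0].
  rewrite SX0 SY0 mulr1 -(probability_setT P); congr (P _).
  by apply/seteqP; split=> // w _ /=; rewrite le_max lexx.
rewrite EFinM -SXE ?ltW// -SYE ?ltW//.
have := XY _ _ (measurable_itv `[x, +oo[) (measurable_itv `[x, +oo[).
have preim (Z : T -> R) : Z @^-1` `[x, +oo[%classic = [set w | (x <= Z w)%R].
  by apply/seteqP; split=> w /=; rewrite in_itv/= andbT.
rewrite !preim => <-; congr (P _).
apply/seteqP; split=> w /=; rewrite le_max le_min leNgt x0 /=.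
  by move=> /andP.
by move=> [-> ->].
Qed.

Lemma moment1_tail (Z : T -> R) : measurable_fun setT Z -> (forall w, 0 <= Z w)%R ->
  \int[P]_w (Z w)%:E =
  \int[mu]_(x in `[0%R, +oo[) P [set w | (x <= Z w)%R].
Proof.
move=> mZ Z0; transitivity (\int[P]_w \int[mu]_(x in `[0%R, Z w]) 1%:E).
  by apply: eq_integral => w _; rewrite integral_itv0c_cst1.
rewrite (@layer_cake _ _ _ P Z (fun=> 1%R))//.
by apply: eq_integral => x _; rewrite mul1e.
Qed.

Lemma moment2_tail (Z : T -> R) : measurable_fun setT Z -> (forall w, 0 <= Z w)%R ->
  \int[P]_w (Z w ^+ 2)%:E =
  \int[mu]_(x in `[0%R, +oo[) ((2 * x)%:E * P [set w | (x <= Z w)%R]).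
Proof.
move=> mZ Z0.
transitivity (\int[P]_w \int[mu]_(x in `[0%R, Z w]) (2 * x)%:E).
  by apply: eq_integral => w _; rewrite integral_itv0c_double.
rewrite (@layer_cake _ _ _ P Z (fun x => 2 * x)%R)//.
- exact: measurable_funM.
- by move=> x x0; exact: mulr_ge0.
Qed.

Section good_stay_moments.
Variables (r s : R) (X Y : {RV P >-> R}).
Hypotheses (r0 : (0 < r)%R) (s0 : (0 < s)%R).
Hypotheses (Xr : exponential_RV r X) (Ys : exponential_RV s Y).
Hypothesis XY : indep_mfun P X Y.

Let tail x : (0 <= x)%R ->
  P [set w | (x <= minp X Y w)%R] = (expR (- (r + s) * x))%:E.
Proof.
move=> x0; rewrite (@min_tail X Y _ _ x XY
  (fun t => exponential_RV_ge (t := t) r0 Xr) (fun t => exponential_RV_ge (t := t) s0 Ys))//.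
- by rewrite -expRD opprD mulrDl.
- by rewrite mulr0 expR0.
- by rewrite mulr0 expR0.
Qed.

Let rs0 : (0 < r + s)%R. Proof. exact: addr_gt0. Qed.

Lemma good_stay_moment1 : \int[P]_w (minp X Y w)%:E = (r + s)^-1%:E.
Proof.
rewrite moment1_tail//; last by move=> w; rewrite le_max lexx.
transitivity (\int[mu]_(x in `[0%R, +oo[) (expR (- (r + s) * x))%:E).
  by apply: eq_integral => x; rewrite inE/= in_itv/= andbT => /tail.
by rewrite integral_expR_itvcy// mulr0 expR0 mul1r.
Qed.

Lemma good_stay_moment2 :
  \int[P]_w (minp X Y w ^+ 2)%:E = (2 / (r + s) ^+ 2)%:E.
Proof.
rewrite moment2_tail//; last by move=> w; rewrite le_max lexx.
transitivity (\int[mu]_(x in `[0%R, +oo[) (2%:E * (x * expR (- (r + s) * x))%:E)).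
  apply: eq_integral => x; rewrite inE/= in_itv/= andbT => /tail ->.
  by rewrite -!EFinM mulrA.
rewrite ge0_integralZl//; first by rewrite integral_idM_expR// -EFinM.
  apply/measurable_EFinP; apply: measurable_funM => //.
  exact: measurable_expRM.
by move=> x /=; rewrite in_itv/= andbT => x0; rewrite lee_fin mulr_ge0// expR_ge0.
Qed.

End good_stay_moments.

Section repair_stay_moments.
Variables (r : R) (G : distrFun R) (X eta : {RV P >-> R}).
Hypothesis r0 : (0 < r)%R.
Hypothesis Xr : exponential_RV r X.
Hypothesis eta_G : forall t, P [set w | (eta w < t)%R] = (G t)%:E.
Hypothesis G0 : G x @[x --> (0:R)%R^'+] --> (0 : R)%R.
Hypothesis X_eta : indep_mfun P X eta.

Local Notation p := ((\int[stieltjes G]_(x in `[0%R, +oo[) expR (- r * x))%R : R).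
Local Notation J := ((\int[stieltjes G]_(x in `[0%R, +oo[) (x * expR (- r * x)))%R : R).
Local Notation K := ((\int[lebesgue_measure]_(t in `[0%R, +oo[) (t * expR (- r * t) * G t))%R : R).

Let measurable_G D : measurable_fun D G.
Proof.
apply: measurable_funTS; apply: nondecreasing_measurable => //.
exact: df_nondecreasing.
Qed.

Let G0_eq0 : G 0%R = 0%R.
Proof. exact: (distrFun_le0 eta_G G0). Qed.

Let G_le1 t : (G t <= 1)%R.
Proof. by rewrite -lee_fin -eta_G probability_le1//; apply: measurable_lt_fun => //; exact: measurable_funP. Qed.

Let SX t : (0 <= t)%R -> P [set w | (t <= X w)%R] = (expR (- r * t))%:E.
Proof. exact: exponential_RV_ge. Qed.

Let Seta t : (0 <= t)%R -> P [set w | (t <= eta w)%R] = (1 - G t)%:E.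
Proof. by move=> _; exact: repair_ge. Qed.

Let tail x : (0 <= x)%R ->
  P [set w | (x <= minp X eta w)%R] = (expR (- r * x) * (1 - G x))%:E.
Proof.
move=> x0; rewrite (min_tail X_eta SX Seta)//.
  by rewrite mulr0 expR0.
by rewrite G0_eq0 subr0.
Qed.

(** The mass of ]-oo, 0[ is P(eta < 0) = G 0 = 0. *)
Let integral_repair_itv (f : R -> \bar R) :
  measurable_fun [set: R] f -> (forall y, 0 <= f y) ->
  \int[P]_w f (eta w) = \int[stieltjes G]_(y in `[0%R, +oo[) f y.
Proof.
move=> mf f0; rewrite (ge0_integral_repair eta_G)//.
rewrite (@ge0_negligible_integral _ (measurableTypeR R) _ (stieltjes G) setT `]-oo, 0%R[%classic f)//.
  by congr integral; rewrite setTD setCitvl.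
change (stieltjes G `]-oo, 0%R[%classic = 0).
rewrite -(repair_preimage eta_G)//.
rewrite (_ : eta @^-1` _ = [set w | (eta w < 0)%R]) ?eta_G ?G0_eq0//.
Qed.

(** Given eta = y, the repair is completed with probability P(X >= y). *)
Let integral_completed (f : R -> R) :
  measurable_fun [set: R] f -> (forall y, 0 <= f y)%R ->
  \int[P]_w (f (eta w) * (eta w <= X w)%R%:R)%:E =
  \int[stieltjes G]_(y in `[0%R, +oo[) (f y * expR (- r * y))%:E.
Proof.
move=> mf f0.
have eta_X : indep_mfun P eta X by move=> A B mA mB; rewrite setIC muleC X_eta.
pose h (z : R * R) : \bar R := (f z.1 * (z.1 <= z.2)%R%:R)%:E.
have mh : measurable_fun [set: R * R] h.
  apply/measurable_EFinP; apply: measurable_funM; first exact: measurableT_comp.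
  rewrite (_ : (fun z : R * R => _) = \1_[set z : R * R | (z.1 <= z.2)%R]).
    by apply: measurable_indic; exact: measurable_le_fun.
  by apply/funext => z; rewrite indicE mem_setE.
have h0 z : 0 <= h z by rewrite lee_fin mulr_ge0.
rewrite (indep_integral eta_X mh h0).
pose S (y : R) : \bar R := P [set w | (y <= X w)%R].
have inner y : \int[distribution P X]_x h (y, x) = (f y)%:E * S y.
  rewrite /h /=; under eq_integral do rewrite EFinM.
  have mle : measurable [set x : R | (y <= x)%R].
    by apply: measurable_le_fun.
  rewrite ge0_integralZl//; last 2 first.
  - apply/measurable_EFinP.
    rewrite (_ : (fun x : R => _) = \1_[set x : R | (y <= x)%R]).
      exact: measurable_indic.
    by apply/funext => z; rewrite indicE mem_setE.
  - by rewrite lee_fin.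
  congr (_ * _).
  transitivity (\int[distribution P X]_x (\1_[set x : R | (y <= x)%R] x)%:E).
    by apply: eq_integral => x _; rewrite indicE mem_setE.
  by rewrite integral_indic// setIT.
have mS : measurable_fun [set: R] S.
  rewrite (_ : S = EFin \o (fun y => fine (S y))).
    apply/measurable_EFinP; rewrite -[X in measurable_fun _ X]opprK.
    apply: measurableT_comp => //; apply: nondecreasing_measurable => // x y xy.
    rewrite lerN2 fine_le ?fin_num_measure//; try exact: measurable_le_fun.
    rewrite le_measure ?inE//; try exact: measurable_le_fun.
    by move=> w /=; exact: le_trans.
  apply/funext => y /=; rewrite fineK ?fin_num_measure//.
  exact: measurable_le_fun.
pose g y := (f y)%:E * S y.
have mg : measurable_fun [set: R] g.
  by apply: emeasurable_funM => //; exact/measurable_EFinP.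
have g0 y : 0 <= g y by rewrite mule_ge0// lee_fin.
transitivity (\int[distribution P eta]_y g y).
  by apply: eq_integral => y _; rewrite inner.
rewrite (@ge0_integral_distribution _ _ _ _ _ P eta g mg g0) integral_repair_itv//.
by apply: eq_integral => y; rewrite inE/= in_itv/= andbT => y0; rewrite /g /S SX.
Qed.

Let indic_le w : ((eta w <= X w)%R%:R : R) = \1_[set w | (eta w <= X w)%R] w.
Proof. by rewrite indicE mem_setE. Qed.

Let measurable_completed : measurable [set w | (eta w <= X w)%R].
Proof. by apply: measurable_le_fun; exact: measurable_funP. Qed.

Let repair_completedE : P [set w | (eta w <= X w)%R] = p%:E.
Proof.
have := @integral_completed (fun=> 1%R) (@measurable_cst _ _ _ _ _ _) (fun=> ler01).
under eq_integral do rewrite mul1r indic_le.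
rewrite integral_indic// setIT => E; rewrite /Rintegral.
under eq_integral do rewrite -[expR _]mul1r.
by rewrite -E fineK// fin_num_measure.
Qed.

Lemma repair_completed : \int[P]_w ((eta w <= X w)%R%:R)%:E = p%:E.
Proof.
rewrite -repair_completedE; under eq_integral do rewrite indic_le.
by rewrite integral_indic// setIT.
Qed.

Lemma repair_interrupted : P [set w | (X w < eta w)%R] = (1 - p)%:E.
Proof.
rewrite (_ : [set w | _] = ~` [set w | (eta w <= X w)%R]).
  by rewrite probability_setC// repair_completedE.
by apply/seteqP; split=> w /=; rewrite ltNge => /negP.
Qed.

Let pos_eta w := Num.max 0%R (eta w).

Let measurable_pos_eta : measurable_fun setT pos_eta.
Proof. exact: measurable_maxr. Qed.

Let pos_eta_tail x : (0 <= x)%R ->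
  P [set w | (x <= pos_eta w)%R] = (1 - G x)%:E.
Proof.
rewrite le_eqVlt => /predU1P[<-|x0].
  rewrite G0_eq0 subr0 -(probability_setT P); congr (P _).
  by apply/seteqP; split=> // w _ /=; rewrite le_max lexx.
rewrite -Seta ?ltW//; congr (P _).
by apply/seteqP; split=> w /=; rewrite le_max leNgt x0.
Qed.

(** Both sides are the integral of exp(- r y) against dG. *)
Let laplace_pos_eta : \int[P]_w (expR (- r * pos_eta w))%:E = p%:E.
Proof.
pose f y : \bar R := (expR (- r * Num.max 0 y))%:E.
have mf : measurable_fun [set: R] f.
  have mm : measurable_fun [set: R] (fun y : R => Num.max 0%R y).
    exact: measurable_maxr.
  apply/measurable_EFinP.
  exact: (measurableT_comp (@measurable_expRM _ r setT) mm).
have := @integral_repair_itv f mf (fun y => expR_ge0 _).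
rewrite /f => ->; rewrite -repair_completedE.
have := @integral_completed (fun=> 1%R) (@measurable_cst _ _ _ _ _ _) (fun=> ler01).
under eq_integral do rewrite mul1r indic_le.
rewrite integral_indic// setIT => ->.
apply: eq_integral => y; rewrite inE/= in_itv/= andbT => y0.
by rewrite mul1r max_r.
Qed.

Let expR_pos_eta_le1 w : (expR (- r * pos_eta w) <= 1)%R.
Proof. by rewrite /pos_eta expR_le1 mulNr oppr_le0 mulr_ge0 ?(ltW r0)// le_max lexx. Qed.

Let integral_defect : \int[P]_w (1 - expR (- r * pos_eta w))%:E = (1 - p)%:E.
Proof.
have m1 : measurable_fun setT (fun w => (expR (- r * pos_eta w))%:E).
  by apply/measurable_EFinP; exact: (measurableT_comp (@measurable_expRM _ r setT) measurable_pos_eta).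
have i1 : P.-integrable setT (fun w => (expR (- r * pos_eta w))%:E).
  apply/integrableP; split=> //.
  under eq_integral do rewrite gee0_abs ?lee_fin ?expR_ge0//.
  by rewrite laplace_pos_eta ltry.
under eq_integral do rewrite EFinB.
rewrite integralB//; last by apply: finite_measure_integrable_cst.
by rewrite laplace_pos_eta integral_cst//= probability_setT mul1e.
Qed.

(** If p = 1 then exp(- r eta) = 1 almost surely, which contradicts eta > 0. *)
Lemma repair_completed_lt1 : (p < 1)%R.
Proof.
rewrite lt_neqAle; apply/andP; split; last first.
  by rewrite -lee_fin -repair_completedE probability_le1.
apply/negP => /eqP p1.
have m1 : measurable_fun setT (fun w => (1 - expR (- r * pos_eta w))%:E).
  apply/measurable_EFinP; apply: measurable_funB => //.
  exact: (measurableT_comp (@measurable_expRM _ r setT) measurable_pos_eta).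
have : \int[P]_w `|(1 - expR (- r * pos_eta w))%:E| = 0.
  under eq_integral do rewrite gee0_abs ?lee_fin ?subr_ge0//.
  by rewrite integral_defect p1 subrr.
move/(ae_eq_integral_abs P measurableT m1) => ae0.
have aeF : {ae P, forall w, False}.
  have := repair_gt0 eta_G G0; move: ae0; apply: filterS2 => w /(_ I) /= h eta0.
  have : expR (- r * pos_eta w) = expR 0 by rewrite expR0; case: h; lra.
  move=> /expR_inj /eqP; rewrite mulf_eq0 oppr_eq0 gt_eqF//= /pos_eta max_r ?ltW//.
  by rewrite gt_eqF.
have [N [mN N0 FN]] := aeF.
have : P setT <= P N by rewrite le_measure ?inE// => w _; exact: FN.
by rewrite probability_setT N0 leNgt lte_fin ltr01.
Qed.

(** The tail exp(- r x) (1 - G x) of the stay is also the integrand of the layer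
cake formula for eta with h(x) = exp(- r x), whose other side is
E (1 - exp(- r eta)) / r. *)
Lemma repair_stay_moment1 : \int[P]_w (minp X eta w)%:E = ((1 - p) / r)%:E.
Proof.
rewrite moment1_tail//; last by move=> w; rewrite le_max lexx.
transitivity (\int[mu]_(x in `[0%R, +oo[)
    ((expR (- r * x))%:E * P [set w | (x <= pos_eta w)%R])).
  apply: eq_integral => x; rewrite inE/= in_itv/= andbT => x0.
  by rewrite tail// pos_eta_tail// EFinM.
rewrite -layer_cake//; last exact: measurable_expRM.
transitivity (\int[P]_w (r^-1%:E * (1 - expR (- r * pos_eta w))%:E)).
  apply: eq_integral => w _; rewrite integral_itv0c_expR//.
    by rewrite mulrC EFinM.
  by rewrite /pos_eta le_max lexx.
rewrite ge0_integralZl//.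
- by rewrite integral_defect -EFinM mulrC.
- apply/measurable_EFinP; apply: measurable_funB => //.
  exact: (measurableT_comp (@measurable_expRM _ r setT) measurable_pos_eta).
- by move=> w _; rewrite lee_fin subr_ge0.
- by rewrite lee_fin invr_ge0 ltW.
Qed.

Lemma repair_stay_moment2 :
  \int[P]_w (minp X eta w ^+ 2)%:E = (2 / r ^+ 2 - 2 * K)%:E.
Proof.
rewrite moment2_tail//; last by move=> w; rewrite le_max lexx.
pose g x : R := (x * expR (- r * x))%R.
have mg D : measurable_fun D g.
  apply: measurable_funM; first exact: measurable_id.
  exact: (@measurable_expRM _ r D).
have ig : mu.-integrable `[0%R, +oo[ (EFin \o g).
  apply/integrableP; split; first by apply/measurable_EFinP; exact: mg.
  rewrite (_ : integral _ _ _ = (r ^- 2)%:E) ?ltry// -integral_idM_expR//.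
  apply: eq_integral => x; rewrite inE/= in_itv/= andbT => x0.
  by rewrite ger0_norm// /g mulr_ge0// expR_ge0.
have igG : mu.-integrable `[0%R, +oo[ (fun x => (g x * G x)%:E).
  apply: le_integrable ig => //.
    by apply/measurable_EFinP; apply: measurable_funM; [exact: mg|exact: measurable_G].
  move=> x; rewrite /= in_itv/= andbT => x0.
  rewrite lee_fin normrM ler_piMr// ger0_norm ?(distrFun_ge0 eta_G)//.
transitivity (\int[mu]_(x in `[0%R, +oo[) (2%:E * ((g x)%:E - (g x * G x)%:E))).
  apply: eq_integral => x; rewrite inE/= in_itv/= andbT => x0.
  by rewrite tail// -EFinB -!EFinM /g; congr EFin; ring.
rewrite integralZl//; last exact: integrableB.
rewrite integralB//= integral_idM_expR//.
rewrite -[X in _ - X]fineK; last exact: integrable_fin_num.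
by rewrite -EFinB -EFinM mulrBr.
Qed.

Lemma repair_stay_completed :
  \int[P]_w (minp X eta w * (eta w <= X w)%R%:R)%:E = J%:E.
Proof.
have mm : measurable_fun [set: R] (fun y : R => Num.max 0%R y).
  exact: measurable_maxr.
have m0 (y : R) : (0 <= Num.max 0 y)%R by rewrite le_max lexx.
have E := integral_completed mm m0.
have E1 : \int[P]_w (minp X eta w * (eta w <= X w)%R%:R)%:E =
   \int[stieltjes G]_(y in `[0%R, +oo[) (y * expR (- r * y))%:E.
  transitivity (\int[P]_w (Num.max 0%R (eta w) * (eta w <= X w)%R%:R)%:E).
    apply: eq_integral => w _; case: leP => _; rewrite ?mulr0//.
  rewrite E; apply: eq_integral => y; rewrite inE/= in_itv/= andbT => y0.
  by rewrite max_r.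
rewrite E1 /Rintegral fineK// ge0_fin_numE -E1; last first.
  by apply: integral_ge0 => w _; rewrite lee_fin mulr_ge0// le_max lexx.
apply: le_lt_trans (_ : ((1 - p) / r)%:E < +oo); last exact: ltry.
rewrite -repair_stay_moment1; apply: ge0_le_integral => //.
- by move=> w _; rewrite lee_fin mulr_ge0// le_max lexx.
- apply/measurable_EFinP; apply: measurable_funM => //.
  under eq_fun do rewrite indic_le.
  exact: measurable_indic.
- exact/measurable_EFinP.
- move=> w _; rewrite lee_fin ler_piMr//.
  by rewrite lern1 leq_b1.
Qed.

End repair_stay_moments.

End cycle_moments.

(** * Limits, null sets and variances *)

Section limits.
Context {R : realType}.

(** The distance to the fixed point is contracted by p up to a vanishing error. *)
Lemma affine_recursion_cvg (p : R) (u b : nat -> R) (l : R) : 0 <= p < 1 ->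
  (forall n, u n.+1 = b n + p * u n) -> b n @[n --> \oo] --> l ->
  u n @[n --> \oo] --> l / (1 - p).
Proof.
move=> /andP[p0 p1] uE bl.
have q0 : 0 < 1 - p by rewrite subr_gt0.
set L := l / (1 - p).
have LE : L = l + p * L by rewrite /L; field; rewrite gt_eqF.
apply/cvgrPdist_le => e e0.
have /cvgrPdist_le/(_ (e / 2 * (1 - p))) := bl.
case; first by rewrite mulr_gt0// divr_gt0.
move=> N _ hN.
have bound k : `|L - u (k + N)%N| <= p ^+ k * `|L - u N| + e / 2.
  elim: k => [|k IH]; first by rewrite add0n expr0 mul1r lerDl divr_ge0// ltW.
  rewrite addSn uE {1}LE.
  have -> : l + p * L - (b (k + N)%N + p * u (k + N)%N) =
    (l - b (k + N)%N) + p * (L - u (k + N)%N) by ring.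
  apply: (le_trans (ler_normD _ _)).
  have h1 := hN (k + N)%N (leq_addl _ _).
  have h2 : p * `|L - u (k + N)%N| <= p * (p ^+ k * `|L - u N| + e / 2).
    by rewrite ler_wpM2l.
  rewrite normrM (ger0_norm p0) exprS -mulrA; rewrite /= in h1.
  by nra.
have pk : p ^+ k * `|L - u N| @[k --> \oo] --> (0 : R).
  rewrite -(mul0r `|L - u N|); apply: cvgMl.
  by apply: cvg_expr; rewrite ger0_norm.
have /cvgrPdist_le/(_ (e / 2)) := pk.
case; first by rewrite divr_gt0.
move=> M _ hM; exists (M + N)%N => // n /= Mn.
have Nn : (N <= n)%N by apply: leq_trans Mn; rewrite leq_addl.
have := hM (n - N)%N; rewrite /= leq_subRL // addnC Mn => /(_ isT).
rewrite sub0r normrN ger0_norm; last by rewrite mulr_ge0 ?exprn_ge0.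
have := bound (n - N)%N; rewrite subnK// => h1 h2.
by lra.
Qed.

End limits.

Section null_sets.
Local Open Scope ereal_scope.
Context d (T : measurableType d) (R : realType).
Variable mu : {measure set T -> \bar R}.
Import HBNNSimple.

(** A simple function below f, set to 0 on N, is below g and has the same
integral. *)
Lemma ge0_le_integral_null (N : set T) (f g : T -> \bar R) :
  measurable N -> mu N = 0 -> (forall x, 0 <= f x) -> (forall x, 0 <= g x) ->
  (forall x, ~ N x -> f x = g x) -> \int[mu]_x f x <= \int[mu]_x g x.
Proof.
move=> mN N0 f0 g0 fg.
rewrite [X in X <= _]ge0_integralTE// [X in _ <= X]ge0_integralTE//.
apply: ge_ereal_sup => _ [h /= hf <-].
have mNc : measurable (~` N) by exact: measurableC.
pose h' := mul_nnsfun h (indic_nnsfun R mNc).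
apply: ereal_sup_ubound; exists h' => /=.
  move=> x; rewrite /h' /= /mindic indicE; case: (boolP (x \in ~` N)) => xN.
    by rewrite mulr1 (le_trans (hf x))// fg//; rewrite inE in xN.
  by rewrite mulr0.
rewrite -!integralT_nnsfun.
have mE (k : {nnsfun T >-> R}) : measurable_fun setT (fun x => (k x)%:E).
  by apply/measurable_EFinP; exact: measurable_funP.
rewrite (ge0_negligible_integral mN measurableT (mE h') _ N0); last first.
  by move=> x _; rewrite lee_fin.
rewrite (ge0_negligible_integral mN measurableT (mE h) _ N0); last first.
  by move=> x _; rewrite lee_fin.
apply: eq_integral => x; rewrite inE => -[_ Nx].
by rewrite /h' /= /mindic indicE mem_set ?mulr1.
Qed.

Lemma integral_null (N : set T) (f g : T -> \bar R) :
  measurable N -> mu N = 0 -> (forall x, ~ N x -> f x = g x) ->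
  \int[mu]_x f x = \int[mu]_x g x.
Proof.
move=> mN N0 fg; rewrite integralE [RHS]integralE.
have sym f1 g1 : (forall x, 0 <= f1 x) -> (forall x, 0 <= g1 x) ->
  (forall x, ~ N x -> f1 x = g1 x) -> \int[mu]_x f1 x = \int[mu]_x g1 x.
  move=> f0 g0 h; apply/eqP; rewrite eq_le.
  by rewrite !(ge0_le_integral_null mN N0)// => x /h.
by congr (_ - _); apply: sym => // x Nx; rewrite ?funeposE ?funenegE fg.
Qed.

End null_sets.

Section variance_of_limit.
Local Open Scope ereal_scope.
Context d (T : measurableType d) (R : realType) (P : probability T R).

Lemma eq_null_variance (N : set T) (V W : T -> R) :
  measurable N -> P N = 0 -> (forall w, ~ N w -> V w = W w) ->
  'V_P[V] = 'V_P[W].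
Proof.
move=> mN N0 VW; rewrite /variance !unlock.
have -> : \int[P]_w (V w)%:E = \int[P]_w (W w)%:E.
  by apply: (integral_null mN N0) => w Nw; rewrite VW.
apply: (integral_null mN N0) => w Nw; set c := fine _.
by change (((V w - c) * (V w - c))%:E = ((W w - c) * (W w - c))%:E); rewrite VW.
Qed.

Lemma variance_moments (W : T -> R) (e s : R) : measurable_fun setT W ->
  \int[P]_w (W w)%:E = e%:E -> \int[P]_w (W w ^+ 2)%:E = s%:E ->
  'V_P[W] = (s - e ^+ 2)%:E.
Proof.
move=> mW We Ws.
have W2 : W \in Lfun P 2%:E.
  rewrite inE; apply/andP; split; rewrite inE//= /finite_norm.
  rewrite unlock /= poweR_lty//.
  under eq_integral do rewrite powR_mulrn ?normr_ge0// real_normK ?num_real//.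
  by rewrite Ws ltry.
rewrite varianceE// !unlock We.
rewrite (_ : \int[P]_w _ = s%:E) ?EFinB ?expe2 ?expr2//.
Qed.

(** The limit, set to 0 on a null set, is an everywhere limit of measurable
functions; monotone convergence applies to it and to its square. *)
Lemma variance_limit (W : T -> R) (H : nat -> T -> R) (e s : nat -> R) (el sl : R) :
  (forall n, measurable_fun setT (H n)) -> (forall n w, (0 <= H n w)%R) ->
  (forall n w, (H n w <= H n.+1 w)%R) ->
  (forall n, \int[P]_w (H n w)%:E = (e n)%:E) ->
  (forall n, \int[P]_w (H n w ^+ 2)%:E = (s n)%:E) ->
  (e n @[n --> \oo] --> el)%R -> (s n @[n --> \oo] --> sl)%R ->
  {ae P, forall w, exists N, forall n, (N <= n)%N -> H n w = W w} ->
  'V_P[W] = (sl - el ^+ 2)%:E.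
Proof.
move=> mH H0 ndH He Hs eel ssl [N [mN N0 HN]].
have good w : ~ N w -> exists M, forall n, (M <= n)%N -> H n w = W w.
  by move=> Nw; apply: contrapT => h; apply: Nw; exact: HN.
pose cut (f : T -> R) w : R := (f w * \1_(~` N) w)%R.
have cutE f w : ~ N w -> cut f w = f w.
  by move=> Nw; rewrite /cut indicE mem_set ?mulr1.
have cutN f w : N w -> cut f w = 0%R.
  by move=> Nw; rewrite /cut indicE memNset ?mulr0//; exact.
rewrite -(@eq_null_variance N (cut W))//; last exact: cutE.
have mcut n : measurable_fun setT (cut (H n)).
  by apply: measurable_funM => //; apply: measurable_indic; exact: measurableC.
have cut0 n w : (0 <= cut (H n) w)%R by rewrite mulr_ge0.
have ndcut w : {homo (fun n => cut (H n) w) : m n / (m <= n)%N >-> (m <= n)%R}.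
  by apply/nondecreasing_seqP => n; rewrite ler_wpM2r.
have cutcvg w : (cut (H n) w @[n --> \oo] --> cut W w)%R.
  have [Nw|Nw] := pselect (N w).
    rewrite cutN//; under eq_fun do rewrite cutN//; exact: cvg_cst.
  have [M hM] := good w Nw.
  apply: cvg_near_cst; exists M => // n /= Mn.
  by rewrite !cutE// hM.
have mW : measurable_fun setT (cut W).
  by apply: (measurable_fun_cvg mcut) => w _; exact: cutcvg.
have mct (phi : R -> R) (c : nat -> R) (cl : R) : continuous phi ->
   {in [pred x | (0 <= x)%R] &, {homo phi : x y / (x <= y)%R}} -> phi 0%R = 0%R ->
   (forall n, \int[P]_w (phi (H n w))%:E = (c n)%:E) -> (c n @[n --> \oo] --> cl)%R ->
   \int[P]_w (phi (cut W w))%:E = cl%:E.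
  move=> cphi mphi phi0 Hc ccl.
  have mphiH n : measurable_fun setT (fun w => (phi (cut (H n) w))%:E).
    apply/measurable_EFinP; apply: measurableT_comp => //.
    exact: continuous_measurable_fun.
  transitivity (\int[P]_w limn (fun n => (phi (cut (H n) w))%:E)).
    apply: eq_integral => w _; apply/esym/cvg_lim => //.
    apply: cvg_EFin; first exact: nearW.
    by apply: continuous_cvg; [exact: cphi|exact: cutcvg].
  rewrite monotone_convergence//; last 2 first.
  - by move=> n w _; rewrite lee_fin -phi0 mphi// inE.
  - by move=> w _ m n mn; rewrite lee_fin mphi ?inE//; exact: ndcut.
  rewrite (_ : (fun n => _) = EFin \o c).
    by apply/cvg_lim => //; apply: cvg_EFin; first exact: nearW.
  apply/funext => n; rewrite /= -Hc.
  by apply: (integral_null mN N0) => w Nw; rewrite cutE.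
apply: variance_moments => //.
  by apply: (mct id e el) => //; move=> x; exact: cvg_id.
apply: (mct (fun x => x ^+ 2)%R s sl) => //.
- by move=> x; exact: exprn_continuous.
- by move=> x y; rewrite !inE => x0 y0 xy; rewrite lerXn2r.
- by rewrite expr0n.
Qed.

End variance_of_limit.

(** * Moments of x + c u with u independent of (x, c) *)

Section affine_moments.
Local Open Scope ereal_scope.
Context d (T : measurableType d) (R : realType) (P : probability T R).
Context (I : eqType) (X : I -> {RV P >-> R}).
Hypothesis indepX : mutually_independent X.

Lemma subfamily_measurable (J : set I) (f : T -> R) :
  measurable_fun [set: subfamily X J] (f : subfamily X J -> R) ->
  measurable_fun [set: T] f.
Proof.
by move=> mf; exact: (measurableT_comp mf (@subfamily_measurable_id _ _ _ _ _ X J)).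
Qed.

Lemma subfamily_measurable_sub (J K : set I) (f : T -> R) : J `<=` K ->
  measurable_fun [set: subfamily X J] (f : subfamily X J -> R) ->
  measurable_fun [set: subfamily X K] (f : subfamily X K -> R).
Proof.
move=> JK mf _ A mA; have := mf measurableT A mA.
rewrite !setTI; apply: sub_sigma_algebra2 => _ [s [B [us sJ mB ->]]].
by exists s, B; split=> //; exact: subset_trans JK.
Qed.

Variables J K : set I.
Hypothesis JK : J `&` K = set0.

Lemma indepM_moment (f g : T -> R) (a b : R) :
  measurable_fun [set: subfamily X J] (f : subfamily X J -> R) ->
  measurable_fun [set: subfamily X K] (g : subfamily X K -> R) ->
  (forall w, 0 <= f w)%R -> (forall w, 0 <= g w)%R ->
  \int[P]_w (f w)%:E = a%:E -> \int[P]_w (g w)%:E = b%:E ->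
  \int[P]_w (f w * g w)%:E = (a * b)%:E.
Proof.
move=> mf mg f0 g0 fa gb; under eq_integral do rewrite EFinM.
have mfE : measurable_fun [set: subfamily X J] (fun w : subfamily X J => (f w)%:E).
  by apply/measurable_EFinP.
have mgE : measurable_fun [set: subfamily X K] (fun w : subfamily X K => (g w)%:E).
  by apply/measurable_EFinP.
have f0E w : 0 <= (f w)%:E by rewrite lee_fin.
have g0E w : 0 <= (g w)%:E by rewrite lee_fin.
by have := integral_indepM indepX JK mfE mgE f0E g0E; rewrite fa gb -EFinM.
Qed.

Variables x c u : T -> R.
Hypothesis mx : measurable_fun [set: subfamily X J] (x : subfamily X J -> R).
Hypothesis mc : measurable_fun [set: subfamily X J] (c : subfamily X J -> R).
Hypothesis mu : measurable_fun [set: subfamily X K] (u : subfamily X K -> R).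
Hypotheses (x0 : forall w, (0 <= x w)%R) (c0 : forall w, (0 <= c w)%R)
  (u0 : forall w, (0 <= u w)%R).
Variables x1 x2 c1 xc1 u1 u2 : R.
Hypotheses (Ex : \int[P]_w (x w)%:E = x1%:E)
  (Ex2 : \int[P]_w (x w ^+ 2)%:E = x2%:E)
  (Ec : \int[P]_w (c w)%:E = c1%:E)
  (Exc : \int[P]_w (x w * c w)%:E = xc1%:E)
  (Eu : \int[P]_w (u w)%:E = u1%:E) (Eu2 : \int[P]_w (u w ^+ 2)%:E = u2%:E).

Let mxT : measurable_fun [set: T] x. Proof. exact: subfamily_measurable mx. Qed.
Let mcT : measurable_fun [set: T] c. Proof. exact: subfamily_measurable mc. Qed.
Let muT : measurable_fun [set: T] u. Proof. exact: subfamily_measurable mu. Qed.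

Lemma affine_moment1 : \int[P]_w (x w + c w * u w)%:E = (x1 + c1 * u1)%:E.
Proof.
under eq_integral do rewrite EFinD.
rewrite ge0_integralD//.
- by rewrite Ex (indepM_moment mc mu c0 u0 Ec Eu) -EFinD.
- by move=> w _; rewrite lee_fin.
- exact/measurable_EFinP.
- by move=> w _; rewrite lee_fin mulr_ge0.
- by apply/measurable_EFinP; exact: measurable_funM.
Qed.

Hypothesis cc : forall w, (c w ^+ 2 = c w)%R.

(** As c is idempotent, (x + c u)^2 = x^2 + 2 (x c) u + c u^2. *)
Lemma affine_moment2 : \int[P]_w ((x w + c w * u w) ^+ 2)%:E =
  (x2 + 2 * xc1 * u1 + c1 * u2)%:E.
Proof.
transitivity (\int[P]_w ((x w ^+ 2)%:E + (2%:E * (x w * c w * u w)%:E +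
    (c w * u w ^+ 2)%:E))).
  apply: eq_integral => w _; rewrite -!EFinM -!EFinD; congr EFin.
  by ring: (cc w).
have mxc : measurable_fun [set: subfamily X J] (fun w : subfamily X J => x w * c w)%R.
  exact: measurable_funM.
have mu2 : measurable_fun [set: subfamily X K] (fun w : subfamily X K => u w ^+ 2)%R.
  exact: measurable_funX.
have xc0 w : (0 <= x w * c w)%R by rewrite mulr_ge0.
have u20 w : (0 <= u w ^+ 2)%R by rewrite exprn_ge0.
have m1 : measurable_fun setT (fun w => (x w * c w * u w)%:E).
  by apply/measurable_EFinP; apply: measurable_funM => //; exact: measurable_funM.
have m2 : measurable_fun setT (fun w => (c w * u w ^+ 2)%:E).
  by apply/measurable_EFinP; apply: measurable_funM => //; exact: measurable_funX.
rewrite ge0_integralD//; last 4 first.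
- by move=> w _; rewrite lee_fin exprn_ge0.
- by apply/measurable_EFinP; exact: measurable_funX.
- by move=> w _; rewrite adde_ge0// ?mule_ge0// lee_fin mulr_ge0.
- by apply: emeasurable_funD => //; exact: measurable_funeM.
rewrite ge0_integralD//; last 3 first.
- by move=> w _; rewrite mule_ge0// lee_fin mulr_ge0.
- exact: measurable_funeM.
- by move=> w _; rewrite lee_fin mulr_ge0.
rewrite ge0_integralZl//; last by move=> w _; rewrite lee_fin mulr_ge0.
rewrite Ex2 (indepM_moment mxc mu xc0 u0 Exc Eu) (indepM_moment mc mu2 c0 u20 Ec Eu2).
by rewrite -!EFinM -!EFinD mulrA addrA.
Qed.

End affine_moments.

(** * Moments of the truncated busy periods *)

Section system.
Context d (T : measurableType d) (R : realType) (P : probability T R).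

Lemma pairwise_independent (I : eqType) (X : I -> {RV P >-> R}) i j :
  mutually_independent X -> i != j -> indep_mfun P (X i) (X j).
Proof.
move=> indX ij A B mA mB.
apply: (@subfamilies_indep _ _ _ _ _ _ indX [set i] [set j]).
- by apply/seteqP; split => // k [/= ->] /eqP; rewrite (negbTE ij).
- by rewrite -[X in _ X]setTI; apply: subfamily_measurable_proj.
- by rewrite -[X in _ X]setTI; apply: subfamily_measurable_proj.
Qed.

Variables (lambda lambda' : R) (G : distrFun R).
Variables oper standby resid repair : nat -> {RV P >-> R}.
Hypotheses (lambda_gt0 : 0 < lambda) (lambda'_gt0 : 0 < lambda').
Hypothesis G0 : G x @[x --> 0^'+] --> (0 : R).
Hypothesis oper_exp : forall n, exponential_RV lambda (oper n).
Hypothesis standby_exp : forall n, exponential_RV lambda' (standby n).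
Hypothesis resid_exp : forall n, exponential_RV lambda (resid n).
Hypothesis repair_G : forall n t, P [set w | repair n w < t] = (G t)%:E.

Definition clock :=
  join_family (join_family oper standby) (join_family resid repair).
Hypothesis clocks_indep : mutually_independent clock.

(** The clocks read during cycle m have index 2m for the stay in state 0 and index
2m + 1 for the stay in state 1. *)
Definition cycle_of (i : (nat + nat) + (nat + nat)) : nat :=
  match i with inl (inl n) | inl (inr n) | inr (inl n) | inr (inr n) => n./2 end.

Definition good_clocks m : set ((nat + nat) + (nat + nat)) :=
  [set i | if i is inl _ then cycle_of i = m else False].
Definition repair_clocks m : set ((nat + nat) + (nat + nat)) :=
  [set i | if i is inr _ then cycle_of i = m else False].
Definition clocks_from m := [set i | (m <= cycle_of i)%N].

Local Notation sample F w := (F (fun n => oper n w) (fun n => standby n w)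
  (fun n => resid n w) (fun n => repair n w)).

Definition good_stay_rv m w :=
  good_stay (fun n => oper n w) (fun n => standby n w) m.
Definition repair_stay_rv m w :=
  repair_stay (fun n => resid n w) (fun n => repair n w) m.
Definition completed m w : R :=
  (~~ fails (fun n => resid n w) (fun n => repair n w) m)%:R.
Definition failed m w : R :=
  (fails (fun n => resid n w) (fun n => repair n w) m)%:R.
Definition from_good_rv n m w := sample from_good w n m.
Definition from_repair_rv n m w := sample from_repair w n m.
Definition after_failures_rv j n m w := sample after_failures w j n m.

Lemma completedE m w :
  completed m w = \1_[set w | repair m.*2.+1 w <= resid m.*2.+1 w] w.
Proof. by rewrite /completed /fails -leNgt indicE mem_setE. Qed.

Lemma failedE m w :
  failed m w = \1_[set w | resid m.*2.+1 w < repair m.*2.+1 w] w.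
Proof. by rewrite /failed /fails indicE mem_setE. Qed.

Lemma measurable_good_stay_rv m :
  measurable_fun [set: subfamily clock (good_clocks m)] (good_stay_rv m).
Proof.
apply: measurable_maxr => //; apply: measurable_minr.
  apply: (@subfamily_measurable_proj _ _ _ _ _ clock _ (inl (inl m.*2))).
  exact: doubleK.
apply: (@subfamily_measurable_proj _ _ _ _ _ clock _ (inl (inr m.*2))).
exact: doubleK.
Qed.

Lemma measurable_resid m :
  measurable_fun [set: subfamily clock (repair_clocks m)] (resid m.*2.+1 : T -> R).
Proof.
apply: (@subfamily_measurable_proj _ _ _ _ _ clock _ (inr (inl m.*2.+1))).
exact: (half_bit_double m true).
Qed.

Lemma measurable_repair m :
  measurable_fun [set: subfamily clock (repair_clocks m)] (repair m.*2.+1 : T -> R).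
Proof.
apply: (@subfamily_measurable_proj _ _ _ _ _ clock _ (inr (inr m.*2.+1))).
exact: (half_bit_double m true).
Qed.

Lemma measurable_repair_stay_rv m :
  measurable_fun [set: subfamily clock (repair_clocks m)] (repair_stay_rv m).
Proof.
apply: measurable_maxr => //; apply: measurable_minr.
  exact: measurable_resid.
exact: measurable_repair.
Qed.

Lemma measurable_completed m :
  measurable_fun [set: subfamily clock (repair_clocks m)] (completed m).
Proof.
rewrite (_ : completed m = \1_[set w | repair m.*2.+1 w <= resid m.*2.+1 w]); last first.
  by apply/funext => w; rewrite completedE.
apply: (@measurable_indic _ (subfamily clock (repair_clocks m))).
apply: measurable_le_fun; [exact: measurable_repair|exact: measurable_resid].
Qed.

Lemma measurable_failed m :
  measurable_fun [set: subfamily clock (repair_clocks m)] (failed m).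
Proof.
rewrite (_ : failed m = \1_[set w | resid m.*2.+1 w < repair m.*2.+1 w]); last first.
  by apply/funext => w; rewrite failedE.
apply: (@measurable_indic _ (subfamily clock (repair_clocks m))).
apply: measurable_lt_fun; [exact: measurable_resid|exact: measurable_repair].
Qed.

Lemma good_clocks_from m : good_clocks m `<=` clocks_from m.
Proof. by move=> [i|i] //= <-; rewrite /clocks_from /=. Qed.

Lemma repair_clocks_from m : repair_clocks m `<=` clocks_from m.
Proof. by move=> [i|i] //= <-; rewrite /clocks_from /=. Qed.

Lemma clocks_fromS m : clocks_from m.+1 `<=` clocks_from m.
Proof. by move=> i /ltnW. Qed.

Lemma measurable_from_good n m :
  measurable_fun [set: subfamily clock (clocks_from m)] (from_good_rv n m).
Proof.
elim: n m => [|n IH] m; first exact: measurable_cst.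
apply: measurable_funD.
  exact: (subfamily_measurable_sub (@good_clocks_from m) (@measurable_good_stay_rv m)).
apply: measurable_funD.
  exact: (subfamily_measurable_sub (@repair_clocks_from m) (@measurable_repair_stay_rv m)).
apply: measurable_funM.
  exact: (subfamily_measurable_sub (@repair_clocks_from m) (@measurable_completed m)).
exact: (subfamily_measurable_sub (@clocks_fromS m) (IH m.+1)).
Qed.

Definition clocks_after_good m := repair_clocks m `|` clocks_from m.+1.

Lemma measurable_from_repair n m :
  measurable_fun [set: subfamily clock (clocks_after_good m)] (from_repair_rv n m).
Proof.
case: n => [|n]; first exact: measurable_cst.
apply: measurable_funD.
  apply: subfamily_measurable_sub (@measurable_repair_stay_rv m).
  exact: subsetUl.
apply: measurable_funM.
  apply: subfamily_measurable_sub (@measurable_completed m).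
  exact: subsetUl.
apply: subfamily_measurable_sub (@measurable_from_good n m.+1).
exact: subsetUr.
Qed.

Lemma clocks_after_good_from m : clocks_after_good m `<=` clocks_from m.
Proof.
rewrite subUset; split; [exact: repair_clocks_from|exact: clocks_fromS].
Qed.

Lemma measurable_after_failures j n m :
  measurable_fun [set: subfamily clock (clocks_from m)] (after_failures_rv j n m).
Proof.
elim: j n m => [|j IHj] n m.
  apply: subfamily_measurable_sub (@measurable_from_repair n m).
  exact: clocks_after_good_from.
elim: n m => [|n IHn] m; first exact: measurable_cst.
apply: (@measurable_funD _ (subfamily clock (clocks_from m))); apply: measurable_funM.
- exact: (subfamily_measurable_sub (@repair_clocks_from m) (@measurable_completed m)).
- exact: (subfamily_measurable_sub (@clocks_fromS m) (IHn m.+1)).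
- exact: (subfamily_measurable_sub (@repair_clocks_from m) (@measurable_failed m)).
- exact: (subfamily_measurable_sub (@clocks_fromS m) (IHj n m.+1)).
Qed.

Lemma good_repair_disjoint m : good_clocks m `&` clocks_after_good m = set0.
Proof.
apply/seteqP; split => // -[i|i] [] //= im [//|].
by rewrite /clocks_from/= im ltnn.
Qed.

Lemma repair_later_disjoint m : repair_clocks m `&` clocks_from m.+1 = set0.
Proof.
apply/seteqP; split => // -[i|i] [] //= im.
by rewrite /clocks_from/= im ltnn.
Qed.

(** p is the probability that a repair is completed and J the mean of a stay in
state 1 restricted to that event; t1, t2 and y1, y2 are the first two moments
of the stays in states 0 and 1. *)
Let p := \int[stieltjes G]_(x in `[0%R, +oo[) expR (- lambda * x).
Let J := \int[stieltjes G]_(x in `[0%R, +oo[) (x * expR (- lambda * x)).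
Let K := \int[lebesgue_measure]_(t in `[0%R, +oo[) (t * expR (- lambda * t) * G t).
Let t1 := (lambda + lambda')^-1.
Let t2 := 2 / (lambda + lambda') ^+ 2.
Let y1 := (1 - p) / lambda.
Let y2 := 2 / lambda ^+ 2 - 2 * K.

Let oper_standby n m : indep_mfun P (oper n) (standby m).
Proof. exact: (@pairwise_independent _ clock (inl (inl n)) (inl (inr m))). Qed.

Let resid_repair n m : indep_mfun P (resid n) (repair m).
Proof. exact: (@pairwise_independent _ clock (inr (inl n)) (inr (inr m))). Qed.

Lemma good_stay_rv_moment1 m : (\int[P]_w (good_stay_rv m w)%:E = t1%:E)%E.
Proof. exact: (good_stay_moment1 lambda_gt0 lambda'_gt0 (oper_exp _) (standby_exp _)). Qed.

Lemma good_stay_rv_moment2 m : (\int[P]_w (good_stay_rv m w ^+ 2)%:E = t2%:E)%E.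
Proof. exact: (good_stay_moment2 lambda_gt0 lambda'_gt0 (oper_exp _) (standby_exp _)). Qed.

Lemma repair_stay_rv_moment1 m : (\int[P]_w (repair_stay_rv m w)%:E = y1%:E)%E.
Proof. exact: (repair_stay_moment1 lambda_gt0 (resid_exp _) (repair_G _)). Qed.

Lemma repair_stay_rv_moment2 m : (\int[P]_w (repair_stay_rv m w ^+ 2)%:E = y2%:E)%E.
Proof. exact: (repair_stay_moment2 lambda_gt0 (resid_exp _) (repair_G _)). Qed.

Lemma completed_moment m : (\int[P]_w (completed m w)%:E = p%:E)%E.
Proof.
rewrite -(repair_completed lambda_gt0 (resid_exp m.*2.+1) (repair_G m.*2.+1))//.
by apply: eq_integral => w _; rewrite /completed /fails -leNgt.
Qed.

Lemma repair_stay_rv_completed_moment m :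
  (\int[P]_w (repair_stay_rv m w * completed m w)%:E = J%:E)%E.
Proof.
rewrite -(repair_stay_completed lambda_gt0 (resid_exp m.*2.+1) (repair_G m.*2.+1))//.
by apply: eq_integral => w _; rewrite /completed /fails -leNgt.
Qed.

Lemma failed_moment m : (\int[P]_w (failed m w)%:E = (1 - p)%:E)%E.
Proof.
rewrite -(repair_interrupted lambda_gt0 (resid_exp m.*2.+1) (repair_G m.*2.+1))//.
under eq_integral do rewrite failedE.
rewrite integral_indic ?setIT//.
by apply: measurable_lt_fun; exact: measurable_funP.
Qed.

Lemma p_lt1 : p < 1.
Proof. exact: (repair_completed_lt1 lambda_gt0 (resid_exp 0) (repair_G 0)). Qed.

Lemma p_ge0 : 0 <= p.
Proof. by apply: Rintegral_ge0 => x _; exact: expR_ge0. Qed.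

Let completed_ge0 m w : 0 <= completed m w. Proof. by rewrite /completed. Qed.
Let failed_ge0 m w : 0 <= failed m w. Proof. by rewrite /failed. Qed.
Let completed_idem m w : completed m w ^+ 2 = completed m w.
Proof. by rewrite /completed; case: (~~ _); rewrite ?expr1n ?expr0n. Qed.

(** First and second moments of the truncated periods, as the independence of the
cycles dictates them; they do not depend on the first cycle. *)
Fixpoint good_mean n : R := if n is n'.+1 then t1 + (y1 + p * good_mean n') else 0.

Fixpoint good_square n : R :=
  if n is n'.+1 then
    t2 + 2 * t1 * (y1 + p * good_mean n') + (y2 + 2 * J * good_mean n' + p * good_square n')
  else 0.

Definition repair_mean n : R := if n is n'.+1 then y1 + p * good_mean n' else 0.

Definition repair_square n : R :=
  if n is n'.+1 then y2 + 2 * J * good_mean n' + p * good_square n' else 0.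

Lemma from_repair_moments_step n m :
  (\int[P]_w (from_good_rv n m.+1 w)%:E = (good_mean n)%:E)%E ->
  (\int[P]_w (from_good_rv n m.+1 w ^+ 2)%:E = (good_square n)%:E)%E ->
  (\int[P]_w (from_repair_rv n.+1 m w)%:E = (repair_mean n.+1)%:E)%E /\
  (\int[P]_w (from_repair_rv n.+1 m w ^+ 2)%:E = (repair_square n.+1)%:E)%E.
Proof.
move=> E1 E2.
have Y0 w : 0 <= repair_stay_rv m w by exact: repair_stay_ge0.
have U0 w : 0 <= from_good_rv n m.+1 w by exact: from_good_ge0.
split.
  exact: (affine_moment1 clocks_indep (@repair_later_disjoint m) (@measurable_repair_stay_rv m)
    (@measurable_completed m) (@measurable_from_good n m.+1) Y0 (completed_ge0 m) U0
    (repair_stay_rv_moment1 m) (completed_moment m) E1).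
exact: (affine_moment2 clocks_indep (@repair_later_disjoint m) (@measurable_repair_stay_rv m)
    (@measurable_completed m) (@measurable_from_good n m.+1) Y0 (completed_ge0 m) U0
    (repair_stay_rv_moment2 m) (completed_moment m) (repair_stay_rv_completed_moment m) E1 E2 (completed_idem m)).
Qed.

(** The stay in state 0 is an independent summand, which is the case c = 1 of
[affine_moment1] and [affine_moment2]. *)
Lemma from_good_moments n m :
  (\int[P]_w (from_good_rv n m w)%:E = (good_mean n)%:E)%E /\
  (\int[P]_w (from_good_rv n m w ^+ 2)%:E = (good_square n)%:E)%E.
Proof.
elim: n m => [|n IH] m.
  by split; apply: integral0_eq => w _; rewrite /from_good_rv/= ?expr0n.
have [IH1 IH2] := IH m.+1.
have [E1 E2] := from_repair_moments_step IH1 IH2.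
have T0 w : 0 <= good_stay_rv m w by exact: good_stay_ge0.
have U0 w : 0 <= from_repair_rv n.+1 m w by exact: from_repair_ge0.
have one0 (w : T) : 0 <= (cst 1 w : R) by [].
have one1 : (\int[P]_w (cst 1 w)%:E = 1%:E :> \bar R)%E.
  transitivity (\int[P]_w cst 1%:E w)%E => //.
  by rewrite integral_cst//= probability_setT mul1e.
have Tone : (\int[P]_w (good_stay_rv m w * cst 1 w)%:E = t1%:E)%E.
  by under eq_integral do rewrite mulr1; exact: good_stay_rv_moment1.
have mone : measurable_fun [set: subfamily clock (good_clocks m)]
  (cst 1 : subfamily clock (good_clocks m) -> R) by exact: measurable_cst.
have one2 (w : T) : (cst 1 w : R) ^+ 2 = cst 1 w by rewrite expr1n.
have unit1 w : from_good_rv n.+1 m w = good_stay_rv m w + cst 1 w * from_repair_rv n.+1 m w.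
  by rewrite mul1r.
split.
  under eq_integral do rewrite unit1.
  rewrite (affine_moment1 clocks_indep (@good_repair_disjoint m) (@measurable_good_stay_rv m)
    mone (@measurable_from_repair n.+1 m) T0 one0 U0 (good_stay_rv_moment1 m) one1 E1).
  by rewrite mul1r.
under eq_integral do rewrite unit1.
rewrite (affine_moment2 clocks_indep (@good_repair_disjoint m) (@measurable_good_stay_rv m)
    mone (@measurable_from_repair n.+1 m) T0 one0 U0 (good_stay_rv_moment2 m) one1 Tone E1 E2 one2).
by rewrite mul1r.
Qed.

Lemma from_repair_moments n m :
  (\int[P]_w (from_repair_rv n m w)%:E = (repair_mean n)%:E)%E /\
  (\int[P]_w (from_repair_rv n m w ^+ 2)%:E = (repair_square n)%:E)%E.
Proof.
case: n => [|n].
  by split; apply: integral0_eq => w _; rewrite /from_repair_rv/= ?expr0n.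
have [E1 E2] := from_good_moments n m.+1.
exact: from_repair_moments_step.
Qed.

(** The recursion of [after_failures] in expectation, for the moment v of
[from_repair]. *)
Fixpoint mixture (v : nat -> R) j : nat -> R :=
  if j is j'.+1 then
    fix mix n := if n is n'.+1 then p * mix n' + (1 - p) * mixture v j' n' else 0
  else v.

(** Exactly one of the indicators is 1, and each is independent of what follows
the cycle. *)
Lemma split_moment m (f g : T -> R) a b :
  measurable_fun [set: subfamily clock (clocks_from m.+1)]
    (f : subfamily clock (clocks_from m.+1) -> R) ->
  measurable_fun [set: subfamily clock (clocks_from m.+1)]
    (g : subfamily clock (clocks_from m.+1) -> R) ->
  (forall w, 0 <= f w) -> (forall w, 0 <= g w) ->
  (\int[P]_w (f w)%:E = a%:E)%E -> (\int[P]_w (g w)%:E = b%:E)%E ->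
  (\int[P]_w (completed m w * f w + failed m w * g w)%:E = (p * a + (1 - p) * b)%:E)%E.
Proof.
move=> mf mg f0 g0 fa gb.
have E1 := indepM_moment clocks_indep (@repair_later_disjoint m)
  (@measurable_completed m) mf (completed_ge0 m) f0 (completed_moment m) fa.
have E2 := indepM_moment clocks_indep (@repair_later_disjoint m)
  (@measurable_failed m) mg (failed_ge0 m) g0 (failed_moment m) gb.
under eq_integral do rewrite EFinD.
rewrite ge0_integralD//.
- by rewrite E1 E2 -EFinD.
- by move=> w _; rewrite lee_fin mulr_ge0.
- apply/measurable_EFinP; apply: measurable_funM.
    exact: (subfamily_measurable (@measurable_completed m)).
  exact: (subfamily_measurable mf).
- by move=> w _; rewrite lee_fin mulr_ge0.
- apply/measurable_EFinP; apply: measurable_funM.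
    exact: (subfamily_measurable (@measurable_failed m)).
  exact: (subfamily_measurable mg).
Qed.

Lemma after_failures_moments j n m :
  (\int[P]_w (after_failures_rv j n m w)%:E = (mixture repair_mean j n)%:E)%E /\
  (\int[P]_w (after_failures_rv j n m w ^+ 2)%:E = (mixture repair_square j n)%:E)%E.
Proof.
elim: j n m => [|j IHj] n m; first exact: from_repair_moments.
elim: n m => [|n IHn] m.
  by split; apply: integral0_eq => w _; rewrite /after_failures_rv/= ?expr0n.
have [A1 A2] := IHn m.+1; have [B1 B2] := IHj n m.+1.
have A0 w : 0 <= after_failures_rv j.+1 n m.+1 w by exact: after_failures_ge0.
have B0 w : 0 <= after_failures_rv j n m.+1 w by exact: after_failures_ge0.
have mA := @measurable_after_failures j.+1 n m.+1.
have mB := @measurable_after_failures j n m.+1.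
split.
  by have := split_moment mA mB A0 B0 A1 B1.
have := split_moment (measurable_funX 2 mA) (measurable_funX 2 mB)
   (fun w => exprn_ge0 2 (A0 w)) (fun w => exprn_ge0 2 (B0 w)) A2 B2.
move=> <-; apply: eq_integral => w _; congr EFin.
rewrite {1}/after_failures_rv after_failuresS -!/(after_failures_rv _ _ _ _).
rewrite /completed /failed; case: (fails _ _ m) => /=.
  by rewrite !mul0r !add0r !mul1r.
by rewrite !mul0r !addr0 !mul1r.
Qed.

(** Fixed points of the recursions of [good_mean] and [good_square]. *)
Let mean_lim := (t1 + y1) / (1 - p).
Let square_lim :=
  (t2 + 2 * t1 * (y1 + p * mean_lim) + (y2 + 2 * J * mean_lim)) / (1 - p).

Let p01 : 0 <= p < 1. Proof. by rewrite p_ge0 p_lt1. Qed.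

Lemma good_mean_cvg : good_mean n @[n --> \oo] --> mean_lim.
Proof.
apply: (affine_recursion_cvg (b := fun=> t1 + y1) p01); last exact: cvg_cst.
by move=> n /=; rewrite addrA.
Qed.

Lemma good_square_cvg : good_square n @[n --> \oo] --> square_lim.
Proof.
pose b n := t2 + 2 * t1 * (y1 + p * good_mean n) + (y2 + 2 * J * good_mean n).
apply: (affine_recursion_cvg (b := b) p01).
  by move=> n /=; rewrite /b !addrA.
have g := good_mean_cvg.
apply: cvgD; [apply: cvgD; [exact: cvg_cst|apply: cvgMr]|];
  apply: cvgD; [exact: cvg_cst| |exact: cvg_cst|]; exact: cvgMr.
Qed.

Lemma repair_mean_cvg : repair_mean n @[n --> \oo] --> y1 + p * mean_lim.
Proof.
rewrite -(cvg_shiftS repair_mean) /=.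
by apply: cvgD; [exact: cvg_cst|apply: cvgMr; exact: good_mean_cvg].
Qed.

Lemma repair_square_cvg :
  repair_square n @[n --> \oo] --> y2 + 2 * J * mean_lim + p * square_lim.
Proof.
rewrite -(cvg_shiftS repair_square) /=.
apply: cvgD; [apply: cvgD; [exact: cvg_cst|apply: cvgMr; exact: good_mean_cvg]|].
by apply: cvgMr; exact: good_square_cvg.
Qed.

Lemma mixture_cvg v j (l : R) : v n @[n --> \oo] --> l ->
  mixture v j n @[n --> \oo] --> l.
Proof.
move=> vl; elim: j => [//|j IH].
have -> : l = ((1 - p) * l) / (1 - p).
  by rewrite mulrAC mulfV ?mul1r// subr_eq0 eq_sym lt_eqF// p_lt1.
apply: (affine_recursion_cvg (b := fun n => (1 - p) * mixture v j n) p01).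
  by move=> n /=; rewrite addrC.
exact: cvgMr.
Qed.

(** * Failures recur, and the variances *)

(** The indicator that no failure occurs in cycles m to m + n - 1, written as a
product of independent factors. *)
Fixpoint all_completed n m w : R :=
  if n is n'.+1 then completed m w * all_completed n' m.+1 w else 1.

Lemma all_completed_ge0 n m w : 0 <= all_completed n m w.
Proof. by elim: n m => [|n IH] m //=; rewrite mulr_ge0. Qed.

Lemma measurable_all_completed n m :
  measurable_fun [set: subfamily clock (clocks_from m)] (all_completed n m).
Proof.
elim: n m => [|n IH] m; first exact: measurable_cst.
apply: measurable_funM.
  exact: (subfamily_measurable_sub (@repair_clocks_from m) (@measurable_completed m)).
exact: (subfamily_measurable_sub (@clocks_fromS m) (IH m.+1)).
Qed.

Lemma all_completed_moment n m :
  (\int[P]_w (all_completed n m w)%:E = (p ^+ n)%:E)%E.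
Proof.
elim: n m => [|n IH] m.
  transitivity (\int[P]_w cst 1%:E w)%E => //.
  by rewrite integral_cst//= probability_setT mul1e expr0.
rewrite exprS; exact: (indepM_moment clocks_indep (@repair_later_disjoint m)
  (@measurable_completed m) (@measurable_all_completed n m.+1)
  (completed_ge0 m) (all_completed_ge0 n m.+1) (completed_moment m) (IH m.+1)).
Qed.

Local Notation failure w := (fails (fun n => resid n w) (fun n => repair n w)).

Lemma all_completed_eq1 n m w : (forall i, (m <= i)%N -> ~~ failure w i) ->
  all_completed n m w = 1.
Proof.
elim: n m => [//|n IH] m h /=; rewrite IH ?mulr1; last by move=> i /ltnW; exact: h.
by rewrite /completed h.
Qed.

(** The probability of n cycles without a failure is p^n. *)
Lemma failures_recur m :
  {ae P, forall w, exists i, (m <= i)%N && failure w i}.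
Proof.
pose N := \bigcap_i [set w | repair (m + i).*2.+1 w <= resid (m + i).*2.+1 w].
have mN : measurable N.
  apply: bigcapT_measurable => i.
  by apply: measurable_le_fun; exact: measurable_funP.
have NE w : N w -> forall i, (m <= i)%N -> ~~ failure w i.
  by move=> Nw i mi; have := Nw (i - m)%N I; rewrite /= subnKC// /fails -leNgt.
have PN n : (P N <= (p ^+ n)%:E)%E.
  rewrite -(all_completed_moment n m) -[X in (P X <= _)%E]setIT.
  rewrite -(@integral_indic _ _ _ P setT)//; apply: ge0_le_integral => //.
  - by apply/measurable_EFinP; exact: measurable_indic.
  - apply/measurable_EFinP.
    exact: (subfamily_measurable (@measurable_all_completed n m)).
  - move=> w _; rewrite lee_fin indicE; have [wN|_] := boolP (w \in N).
      by rewrite all_completed_eq1//; apply: NE; rewrite inE in wN.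
    exact: all_completed_ge0.
exists N; split => //; last first.
  move=> w /= h i _ /=; rewrite leNgt; apply/negP => f; apply: h.
  by exists (m + i)%N; rewrite leq_addr.
have pn : p ^+ n @[n --> \oo] --> (0 : R).
  by apply: cvg_expr; rewrite ger0_norm ?p_ge0 ?p_lt1.
have : fine (P N) <= 0.
  rewrite -(cvg_lim (@Rhausdorff R) pn); apply: limr_ge.
    by apply/cvg_ex; exists 0; exact: pn.
  by apply: nearW => n; rewrite -lee_fin fineK ?fin_num_measure.
move=> h; apply/eqP; rewrite eq_le measure_ge0 andbT.
by rewrite -(fineK (fin_num_measure P N mN)) lee_fin.
Qed.

Lemma regular_paths : {ae P, forall w,
  [/\ (forall n, 0 < oper n w), (forall n, 0 < standby n w),
      (forall n, 0 < resid n w), (forall n, 0 < repair n w) &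
      (forall m, exists i, (m <= i)%N && failure w i)]}.
Proof.
have o := ae_foralln (fun n => exponential_RV_gt0 lambda_gt0 (oper_exp n)).
have s := ae_foralln (fun n => exponential_RV_gt0 lambda'_gt0 (standby_exp n)).
have r := ae_foralln (fun n => exponential_RV_gt0 lambda_gt0 (resid_exp n)).
have q := ae_foralln (fun n => repair_gt0 (repair_G n) G0).
have f := ae_foralln failures_recur.
near=> w; split.
- by near: w.
- by near: w.
- by near: w.
- by near: w.
- by near: w.
Unshelve. all: by end_near. Qed.

Local Notation W k := (fun w => sample busy_length w k).

Lemma variance_busy1 : 'V_P[W 1%N] = (square_lim - mean_lim ^+ 2)%:E.
Proof.
apply: (@variance_limit _ _ _ P (W 1%N) (fun n w => from_good_rv n 0 w) good_mean good_square).
- by move=> n; exact: (subfamily_measurable (@measurable_from_good n 0)).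
- by move=> n w; exact: from_good_ge0.
- by move=> n w; exact: from_good_nd.
- by move=> n; have [] := from_good_moments n 0.
- by move=> n; have [] := from_good_moments n 0.
- exact: good_mean_cvg.
- exact: good_square_cvg.
- apply: filterS regular_paths => w [ho hs hr hq hf].
  exact: busy_length1.
Qed.

Lemma variance_busyS k : 'V_P[W k.+2] =
  (y2 + 2 * J * mean_lim + p * square_lim - (y1 + p * mean_lim) ^+ 2)%:E.
Proof.
apply: (@variance_limit _ _ _ P (W k.+2) (fun n w => after_failures_rv k.+1 n 0 w)
  (mixture repair_mean k.+1) (mixture repair_square k.+1)).
- by move=> n; exact: (subfamily_measurable (@measurable_after_failures k.+1 n 0)).
- by move=> n w; exact: after_failures_ge0.
- by move=> n w; exact: after_failures_nd.
- by move=> n; have [] := after_failures_moments k.+1 n 0.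
- by move=> n; have [] := after_failures_moments k.+1 n 0.
- by apply: mixture_cvg; exact: repair_mean_cvg.
- by apply: mixture_cvg; exact: repair_square_cvg.
- apply: filterS regular_paths => w [ho hs hr hq hf].
  exact: busy_lengthS.
Qed.

End system.

(** * The stated formulas *)

(** mean and square are the limits of the moments of the truncated busy periods
that start in state 0, with p written as 1 - q. *)
Section variance_identities.
Variables (R : realFieldType) (q l s K J : R).
Hypotheses (q0 : q != 0) (l0 : l != 0) (s0 : s != 0).

Let mean : R := (s^-1 + (1 - (1 - q)) / l) / (1 - (1 - q)).
Let square : R :=
  (2 / s ^+ 2 + 2 * s^-1 * ((1 - (1 - q)) / l + (1 - q) * mean)
   + (2 / l ^+ 2 - 2 * K + 2 * J * mean)) / (1 - (1 - q)).

Lemma first_variance_identity :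
  square - mean ^+ 2 =
  ((2 - q ^+ 2) / l ^+ 2 + 1 / s ^+ 2 - 2 * K) / q
  + ((q / l + 1 / s) ^+ 2 * (q - 1)
     + 2 * (q / l + 1 / s) * (J + (1 - q) / s)) / q ^+ 2.
Proof. by rewrite /square /mean subKr; field; rewrite q0 l0 s0. Qed.

Lemma later_variance_identity :
  2 / l ^+ 2 - 2 * K + 2 * J * mean + (1 - q) * square
    - ((1 - (1 - q)) / l + (1 - q) * mean) ^+ 2 =
  square - mean ^+ 2 - 1 / s ^+ 2.
Proof. by rewrite /square /mean subKr; field; rewrite q0 l0 s0. Qed.

End variance_identities.

Theorem mainTheorem6 (R : realType) (d : measure_display)
    (T : measurableType d) (P : probability T R)
    (lambda lambda' : R) (G : distrFun R)
    (oper standby resid repair : nat -> {RV P >-> R})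
    (tau eta : {RV P >-> R})
    (lambda_gt0 : 0 < lambda)
    (lambda'_gt0 : 0 < lambda')
    (lambda'_lt : lambda' < lambda)
    (G0 : G x @[x --> 0^'+] --> (0 : R))
    (oper_exp : forall n, exponential_RV lambda (oper n))
    (standby_exp : forall n, exponential_RV lambda' (standby n))
    (resid_exp : forall n, exponential_RV lambda (resid n))
    (repair_G : forall n t, P [set w | repair n w < t] = (G t)%:E)
    (clocks_indep : mutually_independent
       (join_family (join_family oper standby) (join_family resid repair)))
    (tau_exp : exponential_RV lambda tau)
    (eta_G : forall t, P [set w | eta w < t] = (G t)%:E)
    (tau_eta_indep : mutually_independent (pair_family tau eta)) :
  let W (k : nat) (w : T) : R :=
    busy_length (fun n => oper n w) (fun n => standby n w)
                (fun n => resid n w) (fun n => repair n w) k in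
  let q : R := fine (P [set w | tau w < eta w]) in
  let a : R := q / lambda + 1 / (lambda + lambda') in
  let sigma2 : R :=
    (2 - q ^+ 2) / lambda ^+ 2 + 1 / (lambda + lambda') ^+ 2
    - 2 * \int[lebesgue_measure]_(t in `[0%R, +oo[)
            (t * expR (- lambda * t) * G t) in
  let a0 : R :=
    \int[stieltjes G]_(t in `[0%R, +oo[) (t * expR (- lambda * t))
    + (1 - q) / (lambda + lambda') in
  [/\ q = 1 - \int[stieltjes G]_(x in `[0%R, +oo[) expR (- lambda * x),
      'V_P[W 1%N]
        = (sigma2 / q + (a ^+ 2 * (q - 1) + 2 * a * a0) / q ^+ 2)%:E
    & forall k : nat, (2 <= k)%N ->
      'V_P[W k] = ('V_P[W 1%N] - (1 / (lambda + lambda') ^+ 2)%:E)%E].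
Proof.
move=> W q a sigma2 a0.
have tau_eta : indep_mfun P tau eta.
  exact: (@pairwise_independent _ _ _ P _ (pair_family tau eta) true false).
have qE : q = 1 - \int[stieltjes G]_(x in `[0%R, +oo[) expR (- lambda * x).
  by rewrite /q (repair_interrupted lambda_gt0 tau_exp eta_G G0 tau_eta).
have q0 : 0 < q.
  by rewrite qE subr_gt0 (repair_completed_lt1 lambda_gt0 tau_exp eta_G G0 tau_eta).
have V1 := variance_busy1 lambda_gt0 lambda'_gt0 G0 oper_exp standby_exp resid_exp
  repair_G clocks_indep.
have VS := variance_busyS lambda_gt0 lambda'_gt0 G0 oper_exp standby_exp resid_exp
  repair_G clocks_indep.
have l0 : lambda != 0 by rewrite gt_eqF.
have s0 : lambda + lambda' != 0 by rewrite gt_eqF// addr_gt0.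
have q0' : q != 0 by rewrite gt_eqF.
have pE : \int[stieltjes G]_(x in `[0%R, +oo[) expR (- lambda * x) = 1 - q.
  by rewrite qE opprB addrC subrK.
rewrite pE in V1 VS.
split => //.
  rewrite /W V1; congr EFin; rewrite /sigma2 /a0 /a.
  exact: first_variance_identity.
case=> [//|[//|k]] _; rewrite /W V1 VS -EFinB; congr EFin.
exact: later_variance_identity.
Qed.
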